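(* Fix $p\ge1$. For each $n$ let $B_n$ be an $n\times p$ random matrix whose entries belong to the first Wiener chaos $\mathcal{W}_1$ (i.e. are centered jointly Gaussian variables in the closed linear span of the $N_i$), and let $A_n={}^tB_nB_n$. Assume that $A_n$ converges in probability to a deterministic invertible matrix $\Sigma$. Then for every $q\ge1$ there exist $N\in\mathbb{N}$ and $C>0$ such that $\mathbb{E}[\det(A_n)^{-q}]\le C$ for all $n\ge N$. In particular $A_n^{-1}\to\Sigma^{-1}$ in $L^q$ for every $q\ge1$.
   Context: $(N_i)_{i\ge1}$ is an i.i.d. standard Gaussian sequence; $\mathcal{W}_1$ is its first Wiener chaos, the $L^2$-closure of the linear span of the $N_i$. *)

(* Defs.v *)
From HB Require Import structures.
From mathcomp Require Import all_boot all_order all_algebra.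
From mathcomp Require Import all_classical all_reals all_analysis.
Set Implicit Arguments. Unset Strict Implicit. Unset Printing Implicit Defensive.
Import Order.TTheory GRing.Theory Num.Theory.
Import numFieldNormedType.Exports.
Local Open Scope classical_set_scope.
Local Open Scope ring_scope.

Section Defs.
Context d (T : measurableType d) (R : realType) (P : probability T R).

Definition mutually_independent (N : nat -> {RV P >-> R}) : Prop :=
  forall (I : seq nat) (A : nat -> set R), uniq I ->
    (forall i, measurable (A i)) ->
    P (\big[setI/setT]_(i <- I) (N i @^-1` A i)) =
    (\prod_(i <- I) P (N i @^-1` A i))%E.

Definition standard_gaussian (X : {RV P >-> R}) : Prop :=
  forall A : set R, measurable A -> P (X @^-1` A) = normal_prob 0 1 A.

Definition iid_standard_gaussian (N : nat -> {RV P >-> R}) : Prop :=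
  mutually_independent N /\ forall i, standard_gaussian (N i).

Definition in_first_chaos (N : nat -> {RV P >-> R}) (X : T -> R) : Prop :=
  measurable_fun setT X /\
  forall e : R, 0 < e -> exists (k : nat) (a : 'I_k -> R),
    (\int[P]_x ((X x - \sum_(i < k) a i * N i x) ^+ 2)%:E < e%:E)%E.

Definition gram (n p : nat) (B : 'I_n -> 'I_p -> T -> R) (x : T) : 'M[R]_p :=
  let Bx := \matrix_(i < n, j < p) B i j x in (Bx^T *m Bx).

Definition det_inv_pow (p : nat) (q : R) (A : 'M[R]_p) : \bar R :=
  if \det A == 0 then +oo%E else ((\det A) `^ (- q))%:E.

End Defs.

(* Main.v *)
(* For a fixed vector [u] the form [q_A(u) = |B u|^2] is a sum of squares of
   chaos elements, so its Laplace transform is a limit of products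
   [prod (1 + 2 t l)^{-1/2}] with nonnegative eigenvalues [l].  Since [q_A(u)]
   is almost deterministic, all eigenvalues are small while their sum stays
   away from 0; hence [E e^{- t q_A(u)}] decays faster than any prescribed power
   of [t], uniformly over unit vectors [u].  Writing [det(A + delta)^{-1/2}] as a
   Gaussian integral over [u] and exchanging expectations bounds
   [E det(A)^{-1/2}]; block-diagonal copies of [B] give all other powers.  The
   same eigenvalue description bounds [E e^{t tr A}], and the cofactor formula
   then bounds all moments of [A^{-1}], which upgrades the convergence in
   probability of [A^{-1}] to convergence in [L^q]. *)
Require Import Defs.
From HB Require Import structures.
From mathcomp Require Import all_boot all_order all_algebra.
From mathcomp Require Import all_classical all_reals all_analysis.
From mathcomp Require Import perm measurable_realfun.
From mathcomp Require Import ring lra.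
From mathcomp Require complex.
Import Order.TTheory GRing.Theory Num.Theory.
Import numFieldNormedType.Exports.
Local Open Scope classical_set_scope.
Local Open Scope ring_scope.
Set Implicit Arguments. Unset Strict Implicit. Unset Printing Implicit Defensive.

(** The chaos elements are only L^2 limits, so the eigenvalues always belong to finite
    approximations: each sum of squares is replaced by a quadratic form in finitely many [N i],
    close in L^1 up to an arbitrary [e], and the estimates are arranged so that [e] can be sent to
    0. The number of rows is unbounded, so no constant may depend on the number of eigenvalues; the
    decay uses only their sum and their maximum. Both are controlled by the Laplace transform at the
    two points 1 and 2, where the integrand is bounded and Lipschitz, so that convergence in
    probability gives bounds uniform in the unit vector [u]. The decay exponent is [p] because (1 +
    e |u|^2)^{-p} is at most the product of the 1 / (1 + e u_i^2), so that the Gaussian integral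
    over [u] splits into [p] one-dimensional Cauchy integrals. Block copies change the format of the
    matrices, hence the arbitrary row count [r n]. Singular matrices are never excluded beforehand:
    the regularisation and Fatou's lemma account for the value [+oo] of [det_inv_pow]. *)

Ltac mfun := repeat first
  [ exact: measurable_cst | exact: measurable_id | assumption | exact: measurable_funP
  | apply: measurable_funX | apply: measurable_funM | apply: measurable_funB
  | apply: measurable_funD ].

(** * Quadratic forms and Schur complements *)

Section QuadraticForms.
Context {R : realFieldType}.

Definition qform k (G : 'M[R]_k) (u : 'rV[R]_k) : R := (u *m G *m u^T) 0 0.

Definition posdefmx k (G : 'M[R]_k) : Prop :=
  G^T = G /\ forall u, u != 0 -> 0 < qform G u.

Lemma qformE k (G : 'M[R]_k) u :
  qform G u = \sum_i \sum_j u 0 i * G i j * u 0 j.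
Proof.
rewrite /qform mxE exchange_big /=; apply: eq_bigr => j _.
by rewrite !mxE mulr_suml.
Qed.

Lemma qform_gram n k (B : 'M[R]_(n, k)) u :
  qform (B^T *m B) u = \sum_i (\sum_j u 0 j * B i j) ^+ 2.
Proof.
rewrite /qform mulmxA -mulmxA mxE; apply: eq_bigr => i _; rewrite expr2 !mxE.
by congr (_ * _); apply: eq_bigr => j _; rewrite !mxE// mulrC.
Qed.

Lemma qform1 k (u : 'rV[R]_k) : qform 1%:M u = \sum_i u 0 i ^+ 2.
Proof. by rewrite /qform mulmx1 mxE; apply: eq_bigr => i _; rewrite mxE expr2. Qed.

Lemma qformD k (G H : 'M[R]_k) u : qform (G + H) u = qform G u + qform H u.
Proof. by rewrite /qform mulmxDr mulmxDl mxE. Qed.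

Lemma qformZ k (a : R) (G : 'M[R]_k) u : qform (a *: G) u = a * qform G u.
Proof. by rewrite /qform -scalemxAr -scalemxAl mxE. Qed.

Lemma qformZv k (a : R) (G : 'M[R]_k) u : qform G (a *: u) = a ^+ 2 * qform G u.
Proof. by rewrite /qform linearZ /= -scalemxAr -!scalemxAl !mxE mulrA expr2. Qed.

Lemma row_eq0_sum_sqr k (u : 'rV[R]_k) : (\sum_i u 0 i ^+ 2 == 0) = (u == 0).
Proof.
rewrite psumr_eq0; last by move=> i _; exact: sqr_ge0.
apply/allP/eqP => [h|-> i _]; last by rewrite mxE expr0n /= eqxx.
apply/rowP => i; rewrite mxE; apply/eqP; rewrite -sqrf_eq0.
by apply: h; rewrite mem_index_enum.
Qed.

Lemma qform1_gt0 k (u : 'rV[R]_k) : u != 0 -> 0 < qform 1%:M u.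
Proof.
by move=> u0; rewrite qform1 lt0r row_eq0_sum_sqr u0 sumr_ge0// => i _; exact: sqr_ge0.
Qed.

(** Isolates the first coordinate [y]: the Gaussian integral is later computed one variable at a
    time, by completing the square in [y]. *)
Lemma qform_block k (g : R) (b : 'rV[R]_k) (G : 'M[R]_k) (y : R) (v : 'rV[R]_k) :
  qform (block_mx g%:M b b^T G) (row_mx y%:M v) =
  g * y ^+ 2 + 2 * y * (b *m v^T) 0 0 + qform G v.
Proof.
rewrite /qform mul_row_block tr_row_mx mul_row_col tr_scalar_mx !mul_mx_scalar.
rewrite !mul_scalar_mx mulmxDl -scalemxAl.
have -> : v *m b^T = (b *m v^T)^T by rewrite trmx_mul trmxK.
set c := b *m v^T; set q := v *m G *m v^T.
by rewrite !mxE eqxx mulr1n; ring.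
Qed.

Lemma qform_schur k (g : R) (b : 'rV[R]_k) (G : 'M[R]_k) (v : 'rV[R]_k) :
  qform (G - g^-1 *: (b^T *m b)) v = qform G v - (b *m v^T) 0 0 ^+ 2 / g.
Proof.
rewrite qformD -scaleNr qformZ qform_gram big_ord1 [in RHS]mxE.
rewrite (eq_bigr (fun j => v 0 j * b 0 j)) // mulNr [_^-1 * _]mulrC.
by congr (_ - _ ^+ 2 / _); apply: eq_bigr => j _; rewrite mxE mulrC.
Qed.

(** The vector (1, 0) tests [g]. For fixed [v] the form is least at [y = - (b v^T) / g], where its
    value is the Schur complement at [v], so positivity is inherited. *)
Lemma posdef_block k (g : R) (b : 'rV[R]_k) (G : 'M[R]_k) :
  posdefmx (block_mx g%:M b b^T G) ->
  0 < g /\ posdefmx (G - g^-1 *: (b^T *m b)).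
Proof.
move=> [sG pG].
have g0 : 0 < g.
  have := pG (row_mx 1%:M 0); rewrite qform_block trmx0 mulmx0 mxE /qform !mul0mx mxE.
  rewrite !mulr0 !addr0 expr1n mulr1; apply.
  apply/eqP => /matrixP/(_ 0 0); rewrite mxE; case: splitP => // j _.
  by rewrite ord1 !mxE eqxx => /eqP; rewrite oner_eq0.
split => //; split.
  move: sG; rewrite tr_block_mx => /eq_block_mx[_ _ _ Gs].
  by rewrite linearB /= linearZ /= Gs trmx_mul trmxK.
move=> v v0; rewrite qform_schur.
have := pG (row_mx (- ((b *m v^T) 0 0 / g))%:M v); rewrite qform_block.
set c := (b *m v^T) 0 0.
have -> : g * (- (c / g)) ^+ 2 + 2 * - (c / g) * c + qform G v =
  qform G v - c ^+ 2 / g by field; rewrite gt_eqF.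
apply; apply: contra v0 => /eqP/(congr1 rsubmx); rewrite row_mxKr => ->.
by apply/eqP/rowP => j; rewrite !mxE.
Qed.

Lemma det_block_schur k (g : R) (b : 'rV[R]_k) (G : 'M[R]_k) : g != 0 ->
  \det (block_mx g%:M b b^T G) = g * \det (G - g^-1 *: (b^T *m b)).
Proof.
move=> g0; have -> : block_mx g%:M b b^T G =
  block_mx 1%:M 0 (g^-1 *: b^T) 1%:M *m block_mx g%:M b 0 (G - g^-1 *: (b^T *m b)).
  rewrite mulmx_block !mul1mx !mul0mx !addr0 -!scalemxAl addrC subrK.
  by rewrite mul_mx_scalar scalerA mulVf// scale1r.
by rewrite det_mulmx det_lblock det_ublock !det1 !mul1r det_scalar1.
Qed.

Lemma gram_posdef n k (B : 'M[R]_(n, k)) (a t : R) : 0 < a -> 0 <= t ->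
  posdefmx (a%:M + t *: (B^T *m B)).
Proof.
move=> a0 t0; split; first by rewrite linearD /= tr_scalar_mx linearZ /= trmx_mul trmxK.
move=> u u0; rewrite qformD -scalemx1 !qformZ.
apply: ltr_wpDr; last by rewrite mulr_gt0// qform1_gt0.
by rewrite mulr_ge0// qform_gram sumr_ge0// => i _; exact: sqr_ge0.
Qed.

Lemma row_cauchy_schwarz k (u v : 'I_k -> R) :
  (\sum_i u i * v i) ^+ 2 <= (\sum_i u i ^+ 2) * (\sum_i v i ^+ 2).
Proof.
set a := \sum_i u i ^+ 2; set c := \sum_i v i ^+ 2; set b := \sum_i _.
have a0 : 0 <= a by apply: sumr_ge0 => i _; exact: sqr_ge0.
have [/eqP|an0] := eqVneq a 0.
  rewrite psumr_eq0 => [/allP h|i _]; last exact: sqr_ge0.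
  suff -> : b = 0 by rewrite expr0n mulr_ge0// sumr_ge0// => i _; exact: sqr_ge0.
  apply: big1 => i _; have := h i (mem_index_enum _); rewrite sqrf_eq0 => /eqP ->.
  by rewrite mul0r.
have ap : 0 < a by rewrite lt0r an0.
have : 0 <= \sum_i (a * v i - b * u i) ^+ 2 by apply: sumr_ge0 => i _; exact: sqr_ge0.
have -> : \sum_i (a * v i - b * u i) ^+ 2 = a ^+ 2 * c - 2 * a * b * b + b ^+ 2 * a.
  transitivity (\sum_i (a ^+ 2 * v i ^+ 2 - 2 * a * b * (u i * v i) + b ^+ 2 * u i ^+ 2)).
    by apply: eq_bigr => i _; ring.
  by rewrite big_split /= sumrB -!mulr_sumr.
have -> : a ^+ 2 * c - 2 * a * b * b + b ^+ 2 * a = a * (a * c - b ^+ 2) by ring.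
by rewrite pmulr_rge0// subr_ge0.
Qed.

(** By Cauchy-Schwarz the squared Frobenius norm of [B] dominates the form of [B^T *m B] on unit
    vectors. This is what makes exponential moments of the Gaussian form finite at small positive
    exponents. *)
Lemma gram_posdef_small n k (B : 'M[R]_(n, k)) (t : R) : 0 <= t ->
  t * (\sum_i \sum_j B i j ^+ 2) < 1 ->
  posdefmx (1%:M - t *: (B^T *m B)).
Proof.
move=> t0 tB; split; first by rewrite linearB /= trmx1 linearZ /= trmx_mul trmxK.
move=> u u0; rewrite qformD -scaleNr qformZ mulNr subr_gt0 qform_gram.
have u1 := qform1_gt0 u0.
apply: (@le_lt_trans _ _ (t * (\sum_i \sum_j B i j ^+ 2) * qform 1%:M u)).
  rewrite -mulrA ler_wpM2l// mulr_suml ler_sum// => i _.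
  by rewrite mulrC qform1; exact: row_cauchy_schwarz.
by rewrite -ltr_pdivlMr// divff// gt_eqF.
Qed.

(* The [i]-th coordinate of [u] is the polar form of [qform S] at [u] and the
   [i]-th row of the inverse, so this is Cauchy-Schwarz for that form. *)
Lemma psd_coord_le k (S : 'M[R]_k) : S^T = S -> (forall u, 0 <= qform S u) ->
  S \in unitmx -> forall (u : 'rV[R]_k) i, u 0 i ^+ 2 <= (1 + qform S (row i (invmx S))) * qform S u.
Proof.
move=> sS pS uS u i; set w := row i (invmx S).
have wS : (u *m S *m w^T) 0 0 = u 0 i.
  have -> : w^T = invmx S *m delta_mx i 0.
    by rewrite -colE /w tr_row; congr col; rewrite trmx_inv sS.
  by rewrite mulmxA mulmxK// -colE mxE.
have Sw : (w *m S *m u^T) 0 0 = u 0 i.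
  by rewrite -wS -[in LHS](trmxK (w *m S)) -trmx_mul [LHS]mxE trmx_mul sS mulmxA.
set a := qform S u; set c := qform S w; set b := u 0 i.
have H t : 0 <= a + 2 * t * b + t ^+ 2 * c.
  have := pS (u + t *: w); rewrite /qform linearD /= linearZ /=.
  rewrite !mulmxDl !mulmxDr -!scalemxAl -!scalemxAr !mxE.
  move: wS Sw; rewrite !mxE => -> ->; congr (0 <= _).
  rewrite /a /c /b /qform !mxE; ring.
have a0 : 0 <= a := pS u.
have c0 : 0 <= c := pS w.
(* The optimal point would be [- b / c]; [1 + c] is positive even when [c] is 0. *)
have {}H := H (- b / (1 + c)).
have : 0 <= (1 + c) ^+ 2 * (a + 2 * (- b / (1 + c)) * b + (- b / (1 + c)) ^+ 2 * c).
  by apply: mulr_ge0 => //; exact: sqr_ge0.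
have -> : (1 + c) ^+ 2 * (a + 2 * (- b / (1 + c)) * b + (- b / (1 + c)) ^+ 2 * c) =
   (1 + c) * ((1 + c) * a - b ^+ 2) - b ^+ 2.
  by field; rewrite gt_eqF// ltr_pwDl.
rewrite subr_ge0 => h; rewrite -subr_ge0 -(pmulr_rge0 _ (_ : 0 < 1 + c)) ?ltr_pwDl//.
by apply: le_trans h; exact: sqr_ge0.
Qed.

End QuadraticForms.

(** * Eigenvalues of Gram matrices *)

Section GramEigenvalues.
Context {R : rcfType}.
Import complex.
Local Notation C := (complex.complex R).
Local Notation toC := (complex.real_complex R).

(** In the order of [C], [0 <= z] also says that [z] is real. Pairing the eigenvector [v] with its
    conjugate shows that [z] times the squared Hermitian norm of [v] is that of [v B^T]. *)
Lemma gram_eigenvalue_ge0 n k (B : 'M[R]_(n, k)) (z : C) :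
  eigenvalue (map_mx toC (B^T *m B)) z -> 0 <= z.
Proof.
case/eigenvalueP => v vM v0.
pose w := v *m map_mx toC B^T.
have conj_toC (x : R) : Num.conj (toC x) = toC x.
  by apply: conj_Creal; apply/complex.complex_realP; exists x.
have pos m (u : 'rV[C]_m) : 0 <= \sum_j u 0 j * Num.conj (u 0 j).
  by apply: sumr_ge0 => j _; exact: mul_conjC_ge0.
have key : z * (\sum_j v 0 j * Num.conj (v 0 j)) = \sum_j w 0 j * Num.conj (w 0 j).
  have -> : \sum_j w 0 j * Num.conj (w 0 j) = (w *m (map_mx Num.conj w)^T) 0 0.
    by rewrite mxE; apply: eq_bigr => j _; rewrite !mxE.
  have -> : (map_mx Num.conj w)^T = map_mx toC B *m (map_mx Num.conj v)^T.
    rewrite /w map_mxM trmx_mul; congr (_ *m _).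
    by apply/matrixP => i j; rewrite !mxE; exact: conj_toC.
  rewrite mulmxA -[w *m _]mulmxA -map_mxM vM -scalemxAl [in RHS]mxE; congr (_ * _).
  by rewrite mxE; apply: eq_bigr => j _; rewrite !mxE.
have vpos : 0 < \sum_j v 0 j * Num.conj (v 0 j).
  rewrite lt0r pos andbT psumr_eq0; last by move=> j _; exact: mul_conjC_ge0.
  apply: contra v0 => /allP h; apply/eqP/rowP => j; rewrite [RHS]mxE.
  by have := h j (mem_index_enum _); rewrite /= mul_conjC_eq0 => /eqP.
by rewrite -(pmulr_lge0 _ vpos) key pos.
Qed.

(** The characteristic polynomial splits over [C], and its roots, being nonnegative there, are real;
    injectivity of the embedding brings the factorisation back to [R]. *)
Lemma gram_char_poly n k (B : 'M[R]_(n, k)) : exists lam : seq R,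
  (forall x, x \in lam -> 0 <= x) /\
  char_poly (B^T *m B) = \prod_(x <- lam) ('X - x%:P).
Proof.
set M := B^T *m B.
have [r] := closed_field_poly_normal (char_poly (map_mx toC M)).
rewrite (monicP (char_poly_monic _)) scale1r => rE.
have r0 z : z \in r -> 0 <= z.
  move=> zr; apply: (@gram_eigenvalue_ge0 _ _ B).
  by rewrite eigenvalue_root_char rE root_prod_XsubC.
have rRe z : z \in r -> toC (complex.Re z) = z.
  by move=> /r0/ger0_real; exact: complex.RRe_real.
exists (map (@complex.Re R) r); split.
  by move=> _ /mapP[z /r0 z0 ->]; move: z0; rewrite complex.lecE => /andP[].
apply: (@map_poly_inj _ _ toC).
rewrite (map_char_poly toC) rE rmorph_prod big_map /=.
by apply: eq_big_seq => z zr; rewrite rmorphB /= map_polyX map_polyC /= rRe.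
Qed.

(** Laplace transforms of Gaussian forms involve the eigenvalues only through determinants and the
    trace, so a list with multiplicities is enough: the determinant is the rescaled characteristic
    polynomial at [- t^-1], and the trace is, up to sign, its second coefficient. *)
Lemma gram_eigenvalues n k (B : 'M[R]_(n, k)) : exists lam : seq R,
  [/\ forall x, x \in lam -> 0 <= x,
      forall t, \det (1%:M + t *: (B^T *m B)) = \prod_(x <- lam) (1 + t * x) &
      \sum_(x <- lam) x = \sum_i \sum_j B i j ^+ 2].
Proof.
have [lam [lam0 lamE]] := gram_char_poly B; exists lam.
set M := B^T *m B in lamE *.
have sz : size lam = k.
  by have := size_char_poly M; rewrite lamE size_prod_XsubC => -[].
split => // [t|].
  have [->|t0] := eqVneq t 0.
    by rewrite scale0r addr0 det1 big1_seq// => x _; rewrite mul0r addr0.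
  have -> : 1%:M + t *: M = (- t) *: ((- t^-1)%:M - M).
    by rewrite scalerBr (scaleNr t M) opprK scale_scalar_mx mulrNN divff.
  rewrite detZ; have -> : \det ((- t^-1)%:M - M) = (char_poly M).[- t^-1].
    rewrite /char_poly -horner_evalE -det_map_mx; congr (\det _).
    apply/matrixP => i j; rewrite !mxE /= horner_evalE hornerD hornerN hornerC.
    by rewrite hornerMn hornerX.
  have prodC (s : seq R) : (- t) ^+ size s = \prod_(x <- s) (- t).
    by elim: s => [|a s IH]; rewrite ?big_nil ?expr0// big_cons exprS IH.
  rewrite lamE horner_prod -sz prodC -big_split /=; apply: eq_bigr => x _.
  by rewrite hornerXsubC; field.
have -> : \sum_i \sum_j B i j ^+ 2 = \tr M.
  rewrite exchange_big /mxtrace; apply: eq_bigr => j _; rewrite mxE.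
  by apply: eq_bigr => i _; rewrite mxE expr2.
have [k0|k0] := posnP k.
  have /size0nil -> : size lam = 0 by rewrite sz.
  rewrite big_nil /mxtrace.
  by symmetry; apply: big1 => i; have := ltn_ord i; rewrite {2}k0.
apply: oppr_inj; rewrite -coefPn_prod_XsubC ?sz -?lt0n// -lamE.
exact: char_poly_trace.
Qed.

End GramEigenvalues.

(** * One-dimensional Gaussian integrals *)

Lemma measurable_fun_inv_gt0 d (T : measurableType d) (R : realType) (f : T -> R) :
  (forall x, 0 < f x) -> measurable_fun setT f ->
  measurable_fun setT (fun x => (f x)^-1).
Proof.
move=> f0 mf; rewrite (_ : (fun x => _) = (@powR R ^~ (-1)) \o f).
  by apply: measurableT_comp => //; exact: measurable_powR.
by apply/funext => x /=; rewrite powR_inv1// ltW.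
Qed.

Section StandardGaussian.
Context {R : realType}.
Local Notation mu := (@lebesgue_measure R).
Local Notation gamma := (normal_prob (0 : R) 1).

(** The Radon-Nikodym derivative of [gamma] and the explicit density have the same integral over
    every measurable set, hence agree almost everywhere. *)
Lemma integral_standard_normal (f : R -> \bar R) : measurable_fun setT f ->
  (forall x, (0 <= f x)%E) ->
  (\int[gamma]_x f x = \int[mu]_x (f x * (normal_pdf 0 1 x)%:E))%E.
Proof.
move=> mf f0; have gmu := @normal_prob_dominates R 0 1.
rewrite -(Radon_Nikodym_SigmaFinite.change_of_variables gmu)//.
have mpdf : measurable_fun setT (EFin \o normal_pdf (0 : R) 1).
  by apply/measurable_EFinP; exact: measurable_normal_pdf.
have fint := Radon_Nikodym_SigmaFinite.f_integrable gmu.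
have mRN := measurable_int _ fint.
apply: ge0_ae_eq_integral => //.
- exact: emeasurable_funM.
- exact: emeasurable_funM.
- by move=> x _; rewrite mule_ge0// Radon_Nikodym_SigmaFinite.f_ge0.
- by move=> x _; rewrite mule_ge0// lee_fin normal_pdf_ge0.
have ae : ae_eq mu setT (Radon_Nikodym_SigmaFinite.f gamma mu) (EFin \o normal_pdf 0 1).
  apply: integral_ae_eq => // E _ mE.
  by rewrite -(Radon_Nikodym_SigmaFinite.f_integral gmu).
by apply: filterS ae => x /= h /h ->.
Qed.

(** The term [y ^+ 2 / 2] cancels the exponent of the standard density; what is left is, up to a
    constant, the density of variance [1 / g] centred at [- b / g]. *)
Lemma normal_pdf_complete_square (g b y : R) : 0 < g ->
  expR ((y ^+ 2 - g * y ^+ 2 - 2 * y * b) / 2) * normal_pdf 0 1 y =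
  (Num.sqrt g)^-1 * expR (b ^+ 2 / g / 2) * normal_pdf (- b / g) (Num.sqrt g)^-1 y.
Proof.
move=> g0; have sg : 0 < Num.sqrt g by rewrite sqrtr_gt0.
have gn0 : g != 0 by rewrite gt_eqF.
rewrite !normal_pdfE ?oner_eq0 ?invr_eq0 ?gt_eqF//.
rewrite /normal_peak /normal_fun expr1n mul1r exprVn sqr_sqrtr ?ltW//.
rewrite -mulrnAr sqrtrM ?invr_ge0 ?ltW// sqrtrV ?ltW// invfM invrK.
set A := Num.sqrt g; set B := (Num.sqrt _)^-1.
have comb (x z e1 e2 : R) : x != 0 -> x^-1 * e1 * (x * z * e2) = z * (e1 * e2).
  by move=> x0; field.
rewrite comb ?gt_eqF//.
rewrite mulrCA -!expRD; congr (_ * expR _); rewrite -mulr_natr.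
by field.
Qed.

Lemma standard_normal_exp_quadratic (g b : R) : 0 < g ->
  (\int[gamma]_y (expR ((y ^+ 2 - g * y ^+ 2 - 2 * y * b) / 2))%:E =
   ((Num.sqrt g)^-1 * expR (b ^+ 2 / g / 2))%:E)%E.
Proof.
move=> g0; have sg : 0 < Num.sqrt g by rewrite sqrtr_gt0.
rewrite integral_standard_normal; last 2 first.
- by apply/measurable_EFinP; apply: measurableT_comp => //; mfun.
- by move=> x; rewrite lee_fin expR_ge0.
have s0 : (Num.sqrt g)^-1 != 0 by rewrite gt_eqF ?invr_gt0.
set c := _^-1 * _.
transitivity (\int[mu]_y (c%:E * (normal_pdf (- b / g) (Num.sqrt g)^-1 y)%:E))%E.
  apply: eq_integral => y _; rewrite -!EFinM; congr (_%:E).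
  exact: normal_pdf_complete_square.
rewrite ge0_integralZl//.
- by rewrite integral_normal_pdf mule1.
- by apply/measurable_EFinP; exact: measurable_normal_pdf.
- by move=> y _; rewrite lee_fin normal_pdf_ge0.
- by rewrite lee_fin mulr_ge0// ?expR_ge0// invr_ge0 ltW.
Qed.

(** The exponential cancels the Gaussian density and leaves a Cauchy integrand, which
    [(1 + e^-1) / (1 + y ^+ 2)] dominates for every positive [e]. *)
Lemma standard_normal_cauchy_lty (e : R) : 0 < e -> exists2 c : R, 0 <= c &
  (\int[gamma]_y (expR (y ^+ 2 / 2) / (1 + e * y ^+ 2))%:E <= c%:E)%E.
Proof.
move=> e0.
have den (y : R) : 0 < 1 + e * y ^+ 2 by rewrite ltr_pwDl// mulr_ge0 ?sqr_ge0 ?ltW//.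
have den1 (y : R) : 0 < 1 + y ^+ 2 by rewrite ltr_pwDl// sqr_ge0.
have mdinv (a : R) : 0 < a -> measurable_fun setT (fun y : R => (1 + a * y ^+ 2)^-1).
  move=> a0; apply: measurable_fun_inv_gt0; last by mfun.
  by move=> y; rewrite ltr_pwDl// mulr_ge0 ?sqr_ge0 ?ltW.
have mdinv1 : measurable_fun setT (fun y : R => (1 + y ^+ 2)^-1).
  by apply: measurable_fun_inv_gt0 => //; mfun.
pose K := (1 + e^-1) * normal_peak (1 : R).
have K0 : 0 <= K by rewrite mulr_ge0 ?normal_peak_ge0// addr_ge0// invr_ge0 ltW.
exists (K * pi); first by rewrite mulr_ge0// pi_ge0.
rewrite integral_standard_normal; last 2 first.
- apply/measurable_EFinP; apply: measurable_funM; last exact: mdinv.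
  by apply: measurableT_comp => //; mfun.
- by move=> x; rewrite lee_fin divr_ge0 ?expR_ge0// ltW.
apply: (@le_trans _ _ (\int[mu]_y (K%:E * ((1 + y ^+ 2)^-1)%:E)))%E.
  apply: ge0_le_integral => //.
  - by move=> y _; rewrite lee_fin mulr_ge0 ?normal_pdf_ge0// divr_ge0 ?expR_ge0// ltW.
  - apply/measurable_EFinP; apply: measurable_funM; last exact: measurable_normal_pdf.
    by apply: measurable_funM; [apply: measurableT_comp => //; mfun|exact: mdinv].
  - by apply/measurable_EFinP; apply: measurable_funM.
  move=> y _; rewrite -!EFinM lee_fin normal_pdfE ?oner_eq0// /normal_fun.
  have -> : expR (y ^+ 2 / 2) / (1 + e * y ^+ 2) *
    (normal_peak 1 * expR (- (y - 0) ^+ 2 / (1 ^+ 2 *+ 2))) =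
    normal_peak 1 * ((1 + e * y ^+ 2)^-1 * (expR (y ^+ 2 / 2) * expR (- (y ^+ 2 / 2)))).
    rewrite subr0 expr1n -[1 *+ 2]/(2%:R) mulNr; ring.
  rewrite -expRD subrr expR0 mulr1 /K [_ * normal_peak _]mulrC -mulrA.
  rewrite ler_wpM2l ?normal_peak_ge0// -[leLHS]mul1r ler_pdivrMr//.
  rewrite mulrAC ler_pdivlMr// mul1r.
  have -> : (1 + e^-1) * (1 + e * y ^+ 2) = (1 + y ^+ 2) + (e * y ^+ 2 + e^-1).
    by field; rewrite gt_eqF.
  rewrite lerDl; apply: addr_ge0; last by rewrite invr_ge0 ltW.
  by apply: mulr_ge0; [exact: ltW|exact: sqr_ge0].
rewrite ge0_integralZl//; last 2 first.
- exact/measurable_EFinP.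
- by move=> y _; rewrite lee_fin invr_ge0 ltW.
apply: (@le_trans _ _ (K%:E * pi%:E)%E); last by rewrite -EFinM.
apply: lee_wpmul2l; first by rewrite lee_fin.
rewrite ge0_symfun_integralT//.
- have -> : [set x : R | 0 <= x] = `[0, +oo[%classic by rewrite set_itvcy.
  by rewrite integral0y_oneDsqr -EFinM lee_fin mulrC divfK.
- by move=> y; rewrite invr_ge0 ltW.
- exact: continuous_oneDsqrV.
- by move=> y; rewrite /= sqrrN.
Qed.

End StandardGaussian.

(** * Integrating one Gaussian variable independently of others *)

Section IndependentFubini.
Context d (T : measurableType d) (R : realType) (P : probability T R).
Variable N : nat -> {RV P >-> R}.
Hypothesis NG : iid_standard_gaussian N.
Local Notation gamma := (normal_prob (0 : R) 1).

(** A pi-system for the coordinates listed in [I]. [TI I] below is [T] with the sigma-algebra it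
    generates, so that a function of these coordinates is a function on [T] measurable for the
    coarser structure, without any encoding of random vectors. *)
Definition cylinder (I : seq nat) : set (set T) :=
  [set X | exists2 A : nat -> set R, (forall i, measurable (A i)) &
    X = \big[setI/setT]_(i <- I) (N i @^-1` A i)].

Local Notation TI I := (g_sigma_algebraType (cylinder I)).

Lemma cylinder_measurable I X : cylinder I X -> measurable X.
Proof.
case=> A mA ->; apply: bigsetI_measurable => i _.
by rewrite -[X in measurable X]setTI; exact: measurable_funP.
Qed.

Lemma cylinderI I : setI_closed (cylinder I).
Proof.
move=> X Y [A mA ->] [B mB ->]; exists (fun i => A i `&` B i).
  by move=> i; exact: measurableI.
by rewrite -big_split.
Qed.

Lemma cylinderT I : cylinder I setT.
Proof. by exists (fun=> setT) => //; rewrite big1. Qed.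

Lemma measurable_cylinder_coord (I : seq nat) (i : nat) : i \in I ->
  measurable_fun (setT : set (TI I)) (N i : TI I -> R).
Proof.
move=> iI _ Y mY; rewrite setTI; apply: sub_sigma_algebra.
exists (fun k => if k == i then Y else setT) => [k|]; first by case: ifP.
rewrite -bigcap_seq; apply/seteqP; split => [x Yx k /= kI|x /(_ i iI)]; last first.
  by rewrite /= eqxx.
by case: eqP => [->|].
Qed.

Lemma cylinder_subsigma I (A : set (TI I)) : measurable A -> measurable (A : set T).
Proof.
apply: smallest_sub; first exact: sigma_algebra_measurable.
exact: cylinder_measurable.
Qed.

(** For fixed [B] both sides are finite measures in [A]. They agree on cylinders by mutual
    independence, hence on the generated sigma-algebra. *)
Lemma cylinder_indep (I : seq nat) (j : nat) (A : set (TI I)) (B : set R) :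
  uniq (j :: I) -> measurable A -> measurable B ->
  (P ((A : set T) `&` N j @^-1` B) = P (A : set T) * gamma B)%E.
Proof.
move=> uI mA mB.
have mNB : measurable (N j @^-1` B).
  by rewrite -[X in measurable X]setTI; exact: measurable_funP.
have gB : gamma B \is a fin_num by exact: fin_num_measure.
have gB0 : 0 <= fine (gamma B) by rewrite fine_ge0.
have cov : \bigcup_(k in [set: nat]) [set: T] = [set: T] by rewrite bigcup_const//; exists 0%N.
have /(_ _ _ A mA) := @g_sigma_algebra_measure_unique _ R T (cylinder I)
  (@cylinder_measurable I) (fun=> setT) (fun=> cylinderT I) cov
  (mrestr P mNB) (mscale (NngNum gB0) P) (@cylinderI I).
have msE X : (mscale (NngNum gB0) P X = P X * gamma B)%E.
  by rewrite /mscale muleC; congr (_ * _)%E; rewrite -[RHS]fineK.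
move=> H; transitivity (mscale (NngNum gB0) P A); last exact: msE.
apply: H.
- move=> X [C mC ->]; transitivity (P (\big[setI/setT]_(i <- I) (N i @^-1` C i)) * gamma B)%E;
    last by rewrite -msE.
  change (P (\big[setI/setT]_(i <- I) (N i @^-1` C i) `&` N j @^-1` B) =
    P (\big[setI/setT]_(i <- I) (N i @^-1` C i)) * gamma B)%E.
  have E1 := NG.1 I C (proj2 (andP uI)) mC.
  have E2 := NG.1 (j :: I) (fun i => if i == j then B else C i) uI.
  rewrite setIC E1 -(proj2 NG j)// muleC.
  move: E2; rewrite !big_cons eqxx.
  have Cj i : i \in I -> (if i == j then B else C i) = C i.
    by case: eqP => // -> jI; move: uI; rewrite /= jI.
  rewrite (eq_big_seq (fun i => N i @^-1` C i)) => [|i /Cj ->//].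
  rewrite (eq_big_seq (fun i => P (N i @^-1` C i))) => [|i /Cj ->//].
  by apply=> i; case: ifP.
- move=> _; change (P (setT `&` N j @^-1` B) < +oo)%E.
  by rewrite setTI (le_lt_trans (probability_le1 _ _)) ?ltry.
Qed.

(** The joint law of the identity into [TI I] and of [N j] is a product measure, by [cylinder_indep]
    and uniqueness on rectangles; Tonelli then lets the fresh variable be integrated on its own. *)
Lemma indep_fubini (I : seq nat) (j : nat) (h : TI I * R -> \bar R) :
  uniq (j :: I) -> measurable_fun setT h -> (forall z, (0 <= h z)%E) ->
  (\int[P]_x h ((x : TI I), N j x) = \int[P]_x \int[P]_z h ((x : TI I), N j z))%E.
Proof.
move=> uI mh h0.
have mid : measurable_fun (setT : set T) (idfun : T -> TI I).
  by move=> _ Y mY; rewrite setTI; exact: (@cylinder_subsigma I Y mY).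
pose X : {RV P >-> TI I} := HB.pack (idfun : T -> TI I) (isMeasurableFun.Build _ _ T (TI I) idfun mid).
have mXY : measurable_fun (setT : set T) (fun x : T => ((x : TI I), N j x)).
  by apply/measurable_fun_pairP; split => //; exact: measurable_funP.
pose XY : {RV P >-> (TI I * R)%type} := HB.pack (fun x : T => ((x : TI I), N j x))
  (isMeasurableFun.Build _ _ T (TI I * R)%type _ mXY).
rewrite -[LHS](@ge0_integral_distribution _ _ _ _ _ P XY)//.
have E := @product_measure_unique _ _ _ _ _ (distribution P X) (distribution P (N j))
  (distribution P XY).
rewrite (@eq_measure_integral _ _ _ _ (distribution P X \x distribution P (N j))%E); last first.
  move=> A mA _; symmetry; apply: E => // B C mB mC.
  transitivity (P (B : set T) * gamma C)%E; first exact: (cylinder_indep uI mB mC).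
  by congr (_ * _)%E; symmetry; exact: (proj2 NG j).
rewrite fubini_tonelli1// (@ge0_integral_distribution _ _ _ _ _ P X).
- apply: eq_integral => x _.
  apply: (@ge0_integral_distribution _ _ _ _ _ P (N j) (fun y => h ((x : TI I), y))) => //.
  apply: (measurableT_comp mh); apply/measurable_fun_pairP.
  by split; [exact: measurable_cst|exact: measurable_id].
- exact: measurable_fun_fubini_tonelli_F.
- by move=> x; apply: integral_ge0.
Qed.

Lemma integral_gaussian (j : nat) (f : R -> \bar R) :
  measurable_fun setT f -> (forall y, (0 <= f y)%E) ->
  (\int[P]_x f (N j x) = \int[gamma]_y f y)%E.
Proof.
move=> mf f0; rewrite -[LHS](@ge0_integral_distribution _ _ _ _ _ P (N j))//.
have mid : measurable_fun (setT : set (measurableTypeR R)) (idfun : measurableTypeR R -> R).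
  by move=> _ Y mY; rewrite setTI.
pose idR : {RV gamma >-> R} := HB.pack (idfun : measurableTypeR R -> R)
  (isMeasurableFun.Build _ _ (measurableTypeR R) R idfun mid).
rewrite -[RHS](@ge0_integral_distribution _ _ _ _ _ gamma idR f mf f0).
by apply: eq_measure_integral => A mA _; exact: (proj2 NG j).
Qed.

End IndependentFubini.

(** * Integrals over a finite Gaussian vector *)

Lemma integral_cst_prob d (T : measurableType d) (R : realType) (P : probability T R) (c : R) :
  (\int[P]_x c%:E = c%:E)%E.
Proof. by rewrite integral_cst// [X in (_ * X)%E](@probability_setT _ _ _ P) mule1. Qed.

Lemma measurable_qform d (T : measurableType d) (R : realType) k (G : 'M[R]_k)
  (f : 'I_k -> T -> R) : (forall i, measurable_fun setT (f i)) ->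
  measurable_fun setT (fun x => qform G (\row_i f i x)).
Proof.
move=> mf; rewrite (_ : (fun x => _) = (fun x => \sum_i \sum_j f i x * G i j * f j x)).
  by apply: measurable_sum => i; apply: measurable_sum => j; mfun; exact: mf.
by apply/funext => x; rewrite qformE; do 2 apply: eq_bigr => ? _; rewrite !mxE.
Qed.

Section GaussianVector.
Context d (T : measurableType d) (R : realType) (P : probability T R).
Variable N : nat -> {RV P >-> R}.
Hypothesis NG : iid_standard_gaussian N.
Local Notation gamma := (normal_prob (0 : R) 1).
Local Notation TI I := (g_sigma_algebraType (cylinder N I)).

(** The offset [s] serves the induction on [k]: removing the first variable leaves a vector that
    starts at [s.+1]. *)
Definition gvec (s k : nat) (x : T) : 'rV[R]_k := \row_i N (s + i)%N x.

Lemma gvec_split s k x : gvec s (1 + k) x = row_mx (N s x)%:M (gvec s.+1 k x).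
Proof.
apply/rowP => i; rewrite !mxE; case: splitP => j ij; rewrite !mxE ij ?ord1/=.
  by rewrite addn0 mulr1n.
by rewrite addnA addn1.
Qed.

Lemma measurable_gvec_coord s k (i : 'I_k) :
  measurable_fun (setT : set (TI (iota s k))) (fun x : T => N (s + i)%N x).
Proof.
by apply: measurable_cylinder_coord; rewrite mem_iota leq_addr ltn_add2l ltn_ord.
Qed.

(** Since [qform 1%:M] cancels the standard density, this is the classical Gaussian integral.
    Integrating the first coordinate produces [g] to the power -1/2 and turns the form in the other
    coordinates into the Schur complement, which [det_block_schur] matches on the side of the
    determinant. *)
Lemma integral_gaussian_qform k : forall s (G : 'M[R]_k), posdefmx G ->
  (\int[P]_x (expR ((qform 1%:M (gvec s k x) - qform G (gvec s k x)) / 2))%:E =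
   ((Num.sqrt (\det G))^-1)%:E)%E.
Proof.
elim: k => [s G _|k IH s G pG].
  under eq_integral do rewrite !qformE !big_ord0 subrr mul0r expR0.
  by rewrite integral_cst_prob det_mx00 sqrtr1 invr1.
change 'M[R]_(1 + k) in G; pose g := (ulsubmx G) 0 0.
pose b := ursubmx G; pose G' := drsubmx G.
have GE : G = block_mx g%:M b b^T G'.
  rewrite -[LHS]submxK; congr block_mx; first exact: mx11_scalar.
  by rewrite /b trmx_ursub (proj1 pG).
rewrite GE in pG *.
have [g0 pS] := posdef_block pG.
rewrite det_block_schur ?gt_eqF//; set S := G' - _ in pS *.
pose h (z : TI (iota s.+1 k) * R) := (expR ((z.2 ^+ 2 - g * z.2 ^+ 2 -
    2 * z.2 * (b *m (gvec s.+1 k z.1)^T) 0 0) / 2)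
  * expR ((qform 1%:M (gvec s.+1 k z.1) - qform G' (gvec s.+1 k z.1)) / 2))%:E.
have hE x : (expR ((qform 1%:M (gvec s (1 + k) x) -
    qform (block_mx g%:M b b^T G') (gvec s (1 + k) x)) / 2))%:E = h (x, N s x).
  rewrite /h -expRD; congr (expR _)%:E; rewrite gvec_split qform_block.
  have -> : (1%:M : 'M[R]_(1 + k)) = block_mx 1%:M 0 0^T 1%:M.
    by rewrite trmx0 -scalar_mx_block.
  by rewrite qform_block mul0mx mxE /=; field.
rewrite (eq_integral (fun x => h (x, N s x))); last by move=> x _; exact: hE.
have mv (i : 'I_k) : measurable_fun (setT : set (TI (iota s.+1 k) * R)%type)
    (fun z => N (s.+1 + i)%N z.1).
  exact: (measurableT_comp (@measurable_gvec_coord s.+1 k i) measurable_fst).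
have mq (M : 'M[R]_k) : measurable_fun (setT : set (TI (iota s.+1 k) * R)%type)
    (fun z => qform M (gvec s.+1 k z.1)) by exact: (measurable_qform M mv).
have mb : measurable_fun (setT : set (TI (iota s.+1 k) * R)%type)
    (fun z => (b *m (gvec s.+1 k z.1)^T) 0 0).
  rewrite (_ : (fun z => _) = (fun z => \sum_i b 0 i * N (s.+1 + i)%N z.1)).
    by apply: measurable_sum => i; mfun; exact: mv.
  by apply/funext => z; rewrite mxE; apply: eq_bigr => i _; rewrite !mxE.
have m2 : measurable_fun (setT : set (TI (iota s.+1 k) * R)%type) snd := measurable_snd.
rewrite (@indep_fubini _ _ _ _ _ NG (iota s.+1 k) s h); last 3 first.
- exact: (iota_uniq s k.+1).
- by apply/measurable_EFinP; apply: measurable_funM; apply: measurableT_comp => //; mfun.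
- by move=> z; rewrite lee_fin mulr_ge0// expR_ge0.
have -> : (((Num.sqrt (g * \det S))^-1)%:E = ((Num.sqrt g)^-1)%:E * ((Num.sqrt (\det S))^-1)%:E)%E.
  by rewrite sqrtrM ?ltW// invfM EFinM.
rewrite -(IH s.+1 S pS) -ge0_integralZl; last 4 first.
- by [].
- apply/measurable_EFinP; apply: measurableT_comp => //; apply: measurable_funM => //.
  by apply: measurable_funB; apply: measurable_qform => i; exact: measurable_funP.
- by move=> x _; rewrite lee_fin expR_ge0.
- by rewrite lee_fin invr_ge0 sqrtr_ge0.
apply: eq_integral => x _; rewrite /h /=.
set q1 := qform 1%:M _; set q2 := qform G' _; set c := (b *m _) 0 0.
rewrite (@integral_gaussian _ _ _ _ _ NG s
  (fun y => (expR ((y ^+ 2 - g * y ^+ 2 - 2 * y * c) / 2) * expR ((q1 - q2) / 2))%:E)); last 2 first.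
- by apply/measurable_EFinP; apply: measurable_funM => //; apply: measurableT_comp => //; mfun.
- by move=> y; rewrite lee_fin mulr_ge0// expR_ge0.
under eq_integral do rewrite EFinM.
rewrite ge0_integralZr; last 4 first.
- by [].
- by apply/measurable_EFinP; apply: measurableT_comp => //; mfun.
- by move=> y _; rewrite lee_fin expR_ge0.
- by rewrite lee_fin expR_ge0.
rewrite standard_normal_exp_quadratic// -!EFinM -[X in X%:E = _]mulrA -expRD; congr (_ * expR _)%:E.
have alg (x1 x2 x3 x4 : R) : x1 ^+ 2 / x2 / 2 + (x3 - x4) / 2 =
  (x3 - (x4 - x1 ^+ 2 / x2)) / 2 by ring.
by rewrite /S qform_schur; exact: alg.
Qed.

Lemma integral_gaussian_prod (f : R -> R) (c : R) :
  measurable_fun setT f -> (forall y, 0 <= f y) ->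
  (\int[gamma]_y (f y)%:E <= c%:E)%E ->
  forall k s, (\int[P]_x (\prod_(i < k) f (N (s + i)%N x))%:E <= (c ^+ k)%:E)%E.
Proof.
move=> mf f0 fc.
have c0 : 0 <= c.
  by rewrite -lee_fin; apply: le_trans fc; apply: integral_ge0 => y _; rewrite lee_fin.
elim=> [|k IH] s.
  under eq_integral do rewrite big_ord0.
  by rewrite integral_cst_prob expr0.
pose h (z : TI (iota s.+1 k) * R) := (f z.2 * \prod_(i < k) f (N (s.+1 + i)%N z.1))%:E.
rewrite (eq_integral (fun x => h (x, N s x))); last first.
  move=> x _; rewrite big_ord_recl addn0 /h /=; congr (_ * _)%:E.
  by apply: eq_bigr => i _; rewrite /bump /= add1n addSnnS.
rewrite (@indep_fubini _ _ _ _ _ NG (iota s.+1 k) s h); last 3 first.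
- exact: (iota_uniq s k.+1).
- apply/measurable_EFinP; apply: measurable_funM.
    exact: (measurableT_comp mf measurable_snd).
  apply: measurable_prod => i _; apply: (measurableT_comp mf).
  exact: (measurableT_comp (@measurable_gvec_coord s.+1 k i) measurable_fst).
- by move=> z; rewrite lee_fin mulr_ge0// prodr_ge0.
set J := (\int[gamma]_y (f y)%:E)%E in fc.
have J0 : (0 <= J)%E by apply: integral_ge0 => y _; rewrite lee_fin.
rewrite (eq_integral (fun x => J * (\prod_(i < k) f (N (s.+1 + i)%N x))%:E)%E); last first.
  move=> x _; rewrite /h /=; under eq_integral do rewrite EFinM.
  rewrite ge0_integralZr; last 4 first.
- by [].
  - by apply/measurable_EFinP; exact: (measurableT_comp mf).
  - by move=> z _; rewrite lee_fin.
  - by rewrite lee_fin prodr_ge0.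
  by rewrite (@integral_gaussian _ _ _ _ _ NG s (fun y => (f y)%:E))//; exact/measurable_EFinP.
rewrite ge0_integralZl; last 4 first.
- by [].
- apply/measurable_EFinP.
  by apply: measurable_prod => i _; exact: (measurableT_comp mf).
- by move=> x _; rewrite lee_fin prodr_ge0.
- by [].
rewrite exprS EFinM; apply: lee_pmul => //.
by apply: integral_ge0 => x _; rewrite lee_fin prodr_ge0.
Qed.

End GaussianVector.

(** * Inequalities between expectations *)

Section Expectation.
Context d (T : measurableType d) (R : realType) (P : probability T R).

Definition Ex (f : T -> R) : \bar R := (\int[P]_x (f x)%:E)%E.

Local Notation Exle f c := (Order.le (Ex f) (EFin c)).

Lemma Ex_ge0 (f : T -> R) : (forall x, 0 <= f x) -> (0 <= Ex f)%E.
Proof. by move=> f0; apply: integral_ge0 => x _; rewrite lee_fin. Qed.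

Lemma Ex_cst (c : R) : Ex (fun=> c) = c%:E.
Proof. exact: integral_cst_prob. Qed.

Lemma Ex_le (f g : T -> R) : measurable_fun setT f -> measurable_fun setT g ->
  (forall x, 0 <= f x) -> (forall x, f x <= g x) -> (Ex f <= Ex g)%E.
Proof.
move=> mf mg f0 fg; apply: ge0_le_integral => //.
- by move=> x _; rewrite lee_fin.
- exact/measurable_EFinP.
- exact/measurable_EFinP.
- by move=> x _; rewrite lee_fin.
Qed.

(** Stated with real upper bounds [G] and [H] for the expectations, so that pointwise estimates
    integrate without any finiteness argument. *)
Lemma Ex_le_lin2 (f g h : T -> R) (a b G H : R) :
  measurable_fun setT f -> measurable_fun setT g -> measurable_fun setT h ->
  (forall x, 0 <= f x) -> (forall x, 0 <= g x) -> (forall x, 0 <= h x) ->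
  0 <= a -> 0 <= b -> (forall x, f x <= a * g x + b * h x) ->
  (Ex g <= G%:E)%E -> (Ex h <= H%:E)%E -> (Ex f <= (a * G + b * H)%:E)%E.
Proof.
move=> mf mg mh f0 g0 h0 a0 b0 fgh gG hH.
apply: (@le_trans _ _ (a%:E * Ex g + b%:E * Ex h)%E); last first.
  by rewrite EFinD !EFinM; apply: leeD; apply: lee_wpmul2l; rewrite ?lee_fin.
have mgE : measurable_fun setT (fun x => (g x)%:E) by exact/measurable_EFinP.
have mhE : measurable_fun setT (fun x => (h x)%:E) by exact/measurable_EFinP.
have Z (c : R) (k : T -> R) : 0 <= c -> (forall x, 0 <= k x) -> measurable_fun setT (fun x => (k x)%:E) ->
    (c%:E * Ex k = \int[P]_x (c%:E * (k x)%:E))%E.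
  move=> c0 k0 mk; rewrite ge0_integralZl; last 4 first.
  - by [].
  - exact: mk.
  - by move=> x _; rewrite lee_fin.
  - by rewrite lee_fin.
  by [].
rewrite !Z// -ge0_integralD//; last 4 first.
- by move=> x _; rewrite -EFinM lee_fin mulr_ge0.
- exact: measurable_funeM.
- by move=> x _; rewrite -EFinM lee_fin mulr_ge0.
- exact: measurable_funeM.
apply: (@Ex_le f (fun x => a * g x + b * h x)) => //; mfun.
Qed.

Lemma Ex_le_scale (f g : T -> R) (a G : R) :
  measurable_fun setT f -> measurable_fun setT g ->
  (forall x, 0 <= f x) -> (forall x, 0 <= g x) -> 0 <= a ->
  (forall x, f x <= a * g x) -> (Ex g <= G%:E)%E -> (Ex f <= (a * G)%:E)%E.
Proof.
move=> mf mg f0 g0 a0 fg gG.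
have := @Ex_le_lin2 f g (fun=> 0) a 0 G 0; rewrite mulr0 addr0; apply => //.
- by move=> x; rewrite addr0.
- by rewrite Ex_cst.
Qed.

Lemma Ex_sum_le n (f : 'I_n -> T -> R) (G : R) :
  (forall i, measurable_fun setT (f i)) -> (forall i x, 0 <= f i x) ->
  (forall i, Exle (f i) G) -> Exle (fun x => (\sum_i f i x)%R) (G *+ n).
Proof.
move=> mf f0 fG; rewrite /Ex; under eq_integral do rewrite -sumEFin.
rewrite ge0_integral_sum//; last 2 first.
- by move=> i; exact/measurable_EFinP.
- by move=> i x _; rewrite lee_fin.
apply: (@le_trans _ _ (\sum_(i < n) G%:E)%E); first by apply: lee_sum => i _; exact: fG.
by rewrite sumEFin lee_fin sumr_const card_ord.
Qed.

Lemma Ex_sum_le_ex n (f : 'I_n -> T -> R) :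
  (forall i, measurable_fun setT (f i)) -> (forall i x, 0 <= f i x) ->
  (forall i, exists G : R, Exle (f i) G) ->
  exists G : R, Exle (fun x => (\sum_i f i x)%R) G.
Proof.
move=> mf f0 /choice[g fg].
exists ((\sum_i `|g i|) *+ n); apply: Ex_sum_le => // i; apply: (le_trans (fg i)).
rewrite lee_fin (bigD1 i)//= (le_trans (ler_norm _))// lerDl.
by rewrite sumr_ge0.
Qed.

End Expectation.
Arguments Ex {d T R} P f.

(** * Approximation of chaos elements by finite Gaussian combinations *)

Section ChaosApproximation.
Context d (T : measurableType d) (R : realType) (P : probability T R).
Variable N : nat -> {RV P >-> R}.
Hypothesis NG : iid_standard_gaussian N.
Local Notation Ex := (Ex P).
Local Notation Exle f c := (Order.le (Ex f) (EFin c)).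

(** From [y ^+ 2 <= 4 * expR (y ^+ 2 / 4)], whose right side is the quadratic exponential integrand
    at [g = 1 / 2] and [b = 0]. *)
Lemma gaussian_sqr_moment j : exists G : R, Exle (fun x => (N j x) ^+ 2) G.
Proof.
exists (4 * ((Num.sqrt (1 / 2))^-1 * expR (0 ^+ 2 / (1 / 2) / 2))).
apply: (@Ex_le_scale _ _ _ _ _ (fun x => expR ((N j x ^+ 2 - 1 / 2 * N j x ^+ 2 - 2 * N j x * 0) / 2))).
- by apply: measurable_funX.
- by apply: measurableT_comp => //; mfun.
- by move=> x; exact: sqr_ge0.
- by move=> x; exact: expR_ge0.
- by [].
- move=> x; set y := N j x.
  have -> : (y ^+ 2 - 1 / 2 * y ^+ 2 - 2 * y * 0) / 2 = y ^+ 2 / 4 by field.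
  by have := expR_ge1Dx (y ^+ 2 / 4); lra.
rewrite /Ex (@integral_gaussian _ _ _ _ _ NG j
  (fun y => (expR ((y ^+ 2 - 1 / 2 * y ^+ 2 - 2 * y * 0) / 2))%:E)).
- by rewrite standard_normal_exp_quadratic.
- by apply/measurable_EFinP; apply: measurableT_comp => //; mfun.
- by move=> y; rewrite lee_fin expR_ge0.
Qed.

Definition gcomb (k : nat) (a : nat -> R) (x : T) : R := \sum_(i < k) a i * N i x.

Lemma measurable_gcomb k a : measurable_fun setT (gcomb k a).
Proof. by apply: measurable_sum => i; mfun. Qed.

Lemma gcomb_sqr_moment k a : exists G : R, Exle (fun x => gcomb k a x ^+ 2) G.
Proof.
have [|||G EG] := @Ex_sum_le_ex _ _ _ P k (fun i x => N i x ^+ 2).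
- by move=> i; apply: measurable_funX.
- by move=> i x; exact: sqr_ge0.
- by move=> i; exact: gaussian_sqr_moment.
exists ((\sum_(i < k) a i ^+ 2) * G).
apply: (@Ex_le_scale _ _ _ _ _ (fun x => \sum_(i < k) N i x ^+ 2)) => //.
- by apply: measurable_funX; exact: measurable_gcomb.
- by apply: measurable_sum => i; apply: measurable_funX.
- by move=> x; exact: sqr_ge0.
- by move=> x; apply: sumr_ge0 => i _; exact: sqr_ge0.
- by apply: sumr_ge0 => i _; exact: sqr_ge0.
- by move=> x; exact: row_cauchy_schwarz.
Qed.

(** Coefficients are extended by 0 beyond [k], so the same ones work for every larger length;
    finitely many chaos elements can then share one Gaussian vector. *)
Lemma chaos_approx (X : T -> R) (e : R) : in_first_chaos N X -> 0 < e ->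
  exists k (a : nat -> R), forall K, (k <= K)%N ->
    Exle (fun x => ((X x - gcomb K a x) ^+ 2)%R) e.
Proof.
move=> [mX hX] e0; have [k [a ae]] := hX e e0.
pose a' (i : nat) := if insub i is Some j then a j else 0.
exists k, a' => K kK; apply: ltW; apply: le_lt_trans ae.
rewrite le_eqVlt; apply/orP; left; apply/eqP; apply: eq_integral => x _; congr ((_ - _) ^+ 2)%:E.
rewrite /gcomb -(subnKC kK) big_split_ord /= [X in _ + X]big1 ?addr0; last first.
  move=> i _; rewrite /a' insubN ?mul0r//.
  by rewrite -leqNgt leq_addr.
by apply: eq_bigr => i _; rewrite /a' valK.
Qed.

Lemma chaos_sqr_moment (X : T -> R) : in_first_chaos N X ->
  exists G : R, Exle (fun x => X x ^+ 2) G.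
Proof.
move=> hX; have [k [a /(_ k (leqnn k)) ak]] := chaos_approx hX ltr01.
have [G EG] := gcomb_sqr_moment k a.
have mg := measurable_gcomb k a; have mX := hX.1.
exists (2 * 1 + 2 * G).
apply: (Ex_le_lin2 _ _ _ _ _ _ _ _ _ ak EG); try by [].
- by mfun.
- by mfun.
- by mfun.
- by move=> x; exact: sqr_ge0.
- by move=> x; exact: sqr_ge0.
- by move=> x; exact: sqr_ge0.
- move=> x; set y := gcomb k a x.
  by have := sqr_ge0 (X x - 2 * y); nra.
Qed.

(** Pointwise, [|u^2 - v^2| <= (1 + 1/eta) (u - v)^2 + eta u^2], which takes the place of
    Cauchy-Schwarz in L^2. [eta] keeps the last term below [e / 2]; then [f] fixes the accuracy of
    the approximation. *)
Lemma chaos_sqr_approx (X : T -> R) (e : R) : in_first_chaos N X -> 0 < e ->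
  exists k (a : nat -> R), forall K, (k <= K)%N ->
    Exle (fun x => `|X x ^+ 2 - gcomb K a x ^+ 2|) e.
Proof.
move=> hX e0; have [G EG] := chaos_sqr_moment hX; have mX := hX.1.
have G0 : 0 <= G.
  by rewrite -lee_fin; apply: le_trans EG; apply: Ex_ge0 => x; exact: sqr_ge0.
pose eta := e / 2 / (1 + G).
have eta0 : 0 < eta by rewrite divr_gt0 ?divr_gt0// ltr_pwDl.
have c0 : 0 < 1 + eta^-1 by rewrite addr_gt0 ?invr_gt0.
pose f := e / 2 / (1 + eta^-1).
have f0 : 0 < f by rewrite divr_gt0 ?divr_gt0.
have [k [a ak]] := chaos_approx hX f0; exists k, a => K /ak aK.
have mg := measurable_gcomb K a.
apply: (@le_trans _ _ ((1 + eta^-1) * f + eta * G)%:E); last first.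
  rewrite lee_fin /f mulrC divfK ?gt_eqF// [leRHS](splitr e) lerD2l /eta.
  rewrite mulrAC ler_pdivrMr ?ltr_pwDl// ler_wpM2l ?lerDr//.
  by rewrite ltW// divr_gt0.
apply: (Ex_le_lin2 _ _ _ _ _ _ _ _ _ aK EG).
- by apply: measurableT_comp => //; mfun.
- by mfun.
- by mfun.
- by [].
- by move=> x; exact: sqr_ge0.
- by move=> x; exact: sqr_ge0.
- exact: ltW.
- exact: ltW.
- move=> x; move: (X x) (gcomb K a x) => u v.
  have H : 2 * `|u - v| * `|u| <= eta^-1 * (u - v) ^+ 2 + eta * u ^+ 2.
    rewrite -(real_normK (num_real (u - v))) -(real_normK (num_real u)).
    have := sqr_ge0 (`|u - v| - eta * `|u|).
    rewrite -(pmulr_rge0 _ (_ : 0 < eta^-1)) ?invr_gt0// => h.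
    rewrite -subr_ge0; apply: le_trans h _; rewrite le_eqVlt; apply/orP; left.
    by apply/eqP; field; rewrite gt_eqF.
  have -> : u ^+ 2 - v ^+ 2 = (u - v) * (2 * u - (u - v)) by ring.
  rewrite normrM; apply: (@le_trans _ _ (`|u - v| * (2 * `|u| + `|u - v|))).
    rewrite ler_wpM2l//; apply: (le_trans (ler_normB _ _)).
    by rewrite normrM (@ger0_norm _ 2).
  rewrite mulrDr mulrDl mul1r -expr2 real_normK ?num_real//.
  by move: H; rewrite mulrCA mulrA; lra.
Qed.

Lemma chaos_sum_sqr_approx n (X : 'I_n -> T -> R) (e : R) :
  (forall i, in_first_chaos N (X i)) -> 0 < e ->
  exists k (A : 'M[R]_(n, k)),
    Exle (fun x => `|(\sum_i X i x ^+ 2)%R - qform (A^T *m A) (gvec N 0 k x)|) e.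
Proof.
move=> hX e0.
have n0 : 0 < n.+1%:R :> R by rewrite ltr0n.
have e'0 : 0 < e / n.+1%:R by rewrite divr_gt0.
have /choice[k /choice[a ak]] : forall i, exists k (a : nat -> R), forall K, (k <= K)%N ->
    Exle (fun x => `|X i x ^+ 2 - gcomb K a x ^+ 2|) (e / n.+1%:R).
  by move=> i; exact: chaos_sqr_approx.
pose K := \max_i k i; exists K, (\matrix_(i, j) a i j).
have kK i : (k i <= K)%N by exact: leq_bigmax.
have qE x : qform ((\matrix_(i < n, j < K) a i j)^T *m (\matrix_(i < n, j < K) a i j)) (gvec N 0 K x) =
    \sum_i gcomb K (a i) x ^+ 2.
  rewrite qform_gram; apply: eq_bigr => i _; congr (_ ^+ 2).
  by apply: eq_bigr => j _; rewrite !mxE add0n mulrC.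
have mX i : measurable_fun setT (X i) := (hX i).1.
have mg i := measurable_gcomb K (a i).
under [X in Ex X]eq_fun do rewrite qE -sumrB.
apply: (@le_trans _ _ (Ex (fun x => (\sum_i `|X i x ^+ 2 - gcomb K (a i) x ^+ 2|)%R))).
  apply: Ex_le => //.
  - by apply: measurableT_comp => //; apply: measurable_sum => i; mfun; [exact: mX|exact: mg].
  - by apply: measurable_sum => i; apply: measurableT_comp => //; mfun; [exact: mX|exact: mg].
  - by move=> x; exact: ler_norm_sum.
apply: (@le_trans _ _ ((e / n.+1%:R) *+ n)%:E).
  apply: Ex_sum_le => //; last by move=> i; exact: ak.
  by move=> i; apply: measurableT_comp => //; mfun; [exact: mX|exact: mg].
rewrite lee_fin -mulr_natr mulrAC ler_pdivrMr// ler_wpM2l ?ltW// ltr_nat//.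
Qed.

End ChaosApproximation.

(** * Laplace transforms of sums of squares, up to a small error *)

Lemma expR_sub_le (R : realType) (a b : R) : expR a - expR b <= expR a * (a - b).
Proof.
have -> : expR b = expR a * expR (b - a) by rewrite -expRD addrC subrK.
rewrite -[X in X - _]mulr1 -mulrBr ler_wpM2l ?expR_ge0//.
by have := expR_ge1Dx (b - a); lra.
Qed.

(** The factor [1] gives the Lipschitz bound the shape that [Ex_le_lin2] consumes. *)
Lemma expRN_lipschitz (R : realType) (t a b : R) : 0 <= t -> 0 <= a -> 0 <= b ->
  expR (- t * a) <= 1 * expR (- t * b) + t * `|a - b|.
Proof.
move=> t0 a0 b0; rewrite mul1r; have [ab|ba] := leP b a.
  apply: ler_wpDr; first by rewrite mulr_ge0.
  by rewrite ler_expR !mulNr lerN2 ler_wpM2l.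
have := expR_sub_le (- t * a) (- t * b).
have -> : - t * a - - t * b = t * `|a - b|.
  by rewrite distrC ger0_norm ?subr_ge0 ?ltW//; ring.
have h : 0 <= t * `|a - b| by rewrite mulr_ge0.
have e1 : expR (- t * a) <= 1 by rewrite -expR0 ler_expR mulNr oppr_le0 mulr_ge0.
by have := expR_ge0 (- t * a); nra.
Qed.

Section ChaosLaplace.
Context d (T : measurableType d) (R : realType) (P : probability T R).
Variable N : nat -> {RV P >-> R}.
Hypothesis NG : iid_standard_gaussian N.
Local Notation Ex := (Ex P).
Local Notation Exle f c := (Order.le (Ex f) (EFin c)).

(** [t] may be negative as long as the matrix stays positive definite, so the same formula serves
    the decay bound and the exponential moments. *)
Lemma gaussian_gram_laplace n k (A : 'M[R]_(n, k)) (t : R) :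
  posdefmx (1%:M + (2 * t) *: (A^T *m A)) ->
  Ex (fun x => expR (- t * qform (A^T *m A) (gvec N 0 k x))) =
  ((Num.sqrt (\det (1%:M + (2 * t) *: (A^T *m A))))^-1)%:E.
Proof.
move=> pG; rewrite -(integral_gaussian_qform NG 0 pG); apply: eq_integral => x _.
by congr (expR _)%:E; rewrite qformD qformZ; field.
Qed.

Lemma measurable_qgvec k (G : 'M[R]_k) :
  measurable_fun setT (fun x => qform G (gvec N 0 k x)).
Proof. by apply: measurable_qform => i; exact: measurable_funP. Qed.

(** One list [lam] serves all [t], so information at particular values of [t] constrains the
    eigenvalues that govern every other [t]. For positive exponents [Q] is truncated at [L], because
    the exponential is Lipschitz only below a level; the constant is [t * expR (t * L)]. *)
Lemma chaos_laplace_approx n (X : 'I_n -> T -> R) (e : R) :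
  (forall i, in_first_chaos N (X i)) -> 0 < e ->
  let Q x := \sum_i X i x ^+ 2 in
  exists lam : seq R, [/\ forall l, l \in lam -> 0 <= l,
    forall t : R, 0 <= t ->
      Exle (fun x => expR (- t * Q x)) ((Num.sqrt (\prod_(l <- lam) (1 + 2 * t * l)))^-1 + t * e),
    forall t c : R, 0 <= t -> Exle (fun x => expR (- t * Q x)) c ->
      (Num.sqrt (\prod_(l <- lam) (1 + 2 * t * l)))^-1 <= c + t * e &
    forall t L : R, 0 <= t -> 2 * t * (\sum_(l <- lam) l) < 1 ->
      Exle (fun x => expR (t * Num.min (Q x) L))
        ((Num.sqrt (\prod_(l <- lam) (1 - 2 * t * l)))^-1 + t * expR (t * L) * e)].
Proof.
move=> hX e0 Q; have [k [A EA]] := chaos_sum_sqr_approx NG hX e0.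
have [lam [lam0 lamD lamS]] := gram_eigenvalues A.
exists lam; have mX i : measurable_fun setT (X i) := (hX i).1.
have mQ : measurable_fun setT Q by apply: measurable_sum => i; mfun; exact: mX.
have mq := measurable_qgvec (A^T *m A).
set q := fun x => qform (A^T *m A) (gvec N 0 k x) in mq EA.
have Q0 x : 0 <= Q x by apply: sumr_ge0 => i _; exact: sqr_ge0.
have q0 x : 0 <= q x by rewrite /q qform_gram; apply: sumr_ge0 => i _; exact: sqr_ge0.
have mD : measurable_fun setT (fun x => `|Q x - q x|).
  by apply: measurableT_comp => //; exact: measurable_funB.
have mexp (c : R) (f : T -> R) : measurable_fun setT f -> measurable_fun setT (fun x => expR (c * f x)).
  by move=> mf; apply: measurableT_comp => //; mfun.
have Eq t : 0 <= t ->
    Ex (fun x => expR (- t * q x)) = ((Num.sqrt (\prod_(l <- lam) (1 + 2 * t * l)))^-1)%:E.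
  move=> t0; rewrite gaussian_gram_laplace ?lamD//.
  by apply: gram_posdef => //; exact: mulr_ge0.
have close := @expRN_lipschitz R.
split => //.
- move=> t t0; rewrite -[X in X + _]mul1r.
  apply: (Ex_le_lin2 (g := fun x => expR (- t * q x)) (h := fun x => `|Q x - q x|)) => //.
  + exact: mexp.
  + exact: mexp.
  + by move=> x; exact: close.
  + by rewrite Eq.
- move=> t c t0 Ec; rewrite -lee_fin -Eq// -[c]mul1r.
  apply: (Ex_le_lin2 (g := fun x => expR (- t * Q x)) (h := fun x => `|Q x - q x|)) => //.
  + exact: mexp.
  + exact: mexp.
  + by move=> x; rewrite distrC; exact: close.
- move=> t L t0 tl; rewrite -[X in X + _]mul1r.
  apply: (Ex_le_lin2 (g := fun x => expR (t * q x)) (h := fun x => `|Q x - q x|)) => //.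
  + apply: mexp; exact: measurable_minr.
  + exact: mexp.
  + by rewrite mulr_ge0// expR_ge0.
  + move=> x; rewrite mul1r; have [mq'|mq'] := leP (Num.min (Q x) L) (q x).
      apply: ler_wpDr; first by rewrite mulr_ge0// mulr_ge0// expR_ge0.
      by rewrite ler_expR ler_wpM2l.
    rewrite -lerBlDl; apply: (le_trans (expR_sub_le _ _)).
    set m := Num.min (Q x) L in mq' *.
    have mQ' : m <= Q x by rewrite ge_min lexx.
    have mL : m <= L by rewrite ge_min lexx orbT.
    rewrite -mulrBr mulrA [_ * t]mulrC ler_pM//.
    * by rewrite mulr_ge0// expR_ge0.
    * by rewrite subr_ge0 ltW.
    * by rewrite ler_wpM2l// ler_expR ler_wpM2l.
    * by apply: le_trans (ler_norm _); rewrite lerB.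
  + have -> : (fun x => expR (t * q x)) = (fun x => expR (- (- t) * q x)).
      by apply/funext => x; rewrite opprK.
    have E2 : 2 * - t = - (2 * t) by ring.
    rewrite gaussian_gram_laplace E2 ?lamD; last first.
      by rewrite scaleNr; apply: gram_posdef_small; rewrite ?mulr_ge0// -lamS.
    by rewrite lee_fin le_eqVlt; under eq_bigr do rewrite mulNr; rewrite eqxx.
Qed.

End ChaosLaplace.

(** * Fatou's lemma, and products over lists of eigenvalues *)

Lemma fatou_le d (T : measurableType d) (R : realType) (mu : {measure set T -> \bar R})
    (f : nat -> T -> \bar R) (g : T -> \bar R) (C : \bar R) :
  (forall n, measurable_fun setT (f n)) -> (forall n x, (0 <= f n x)%E) ->
  (forall x, f n x @[n --> \oo] --> g x) ->
  (forall n, (\int[mu]_x f n x <= C)%E) -> (\int[mu]_x g x <= C)%E.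
Proof.
move=> mf f0 fg fC.
have := @fatou _ _ _ mu setT measurableT f mf (fun n x _ => f0 n x).
under eq_integral => x _ do rewrite (cvg_limn_einf_sup (fg x)).1.
move=> /le_trans; apply; rewrite limn_einf_lim.
apply: lime_le; first exact: is_cvg_einfs.
apply: nearW => n; apply: le_trans (fC n); apply: ereal_inf_lbound.
by exists n => /=.
Qed.

Section SequenceProducts.
Context {R : realType}.
Implicit Type lam : seq R.

Lemma prod_ge_1D lam (a : R) : (forall l, l \in lam -> 0 <= l) -> 0 <= a ->
  1 + a * (\sum_(l <- lam) l) <= \prod_(l <- lam) (1 + a * l).
Proof.
move=> lam0 a0; elim: lam lam0 => [|x s IH] s0; first by rewrite !big_nil mulr0 addr0.
rewrite !big_cons.
have x0 : 0 <= x by apply: s0; rewrite mem_head.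
have ss0 l : l \in s -> 0 <= l by move=> ls; apply: s0; rewrite in_cons ls orbT.
have {}IH := IH ss0.
have S0 : 0 <= \sum_(l <- s) l by rewrite big_seq sumr_ge0.
have ax : 0 <= a * x by rewrite mulr_ge0.
have aS : 0 <= a * \sum_(l <- s) l by rewrite mulr_ge0.
apply: (@le_trans _ _ ((1 + a * x) * (1 + a * \sum_(l <- s) l))); first by nra.
by rewrite ler_wpM2l// addr_ge0.
Qed.

Lemma prod_ge_1B lam (a : R) : (forall l, l \in lam -> 0 <= l) -> 0 <= a ->
  a * (\sum_(l <- lam) l) <= 1 ->
  1 - a * (\sum_(l <- lam) l) <= \prod_(l <- lam) (1 - a * l).
Proof.
move=> lam0 a0; elim: lam lam0 => [|x s IH] s0; first by rewrite !big_nil mulr0 subr0.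
rewrite !big_cons mulrDr.
have x0 : 0 <= x by apply: s0; rewrite mem_head.
have ss0 l : l \in s -> 0 <= l by move=> ls; apply: s0; rewrite in_cons ls orbT.
have S0 : 0 <= \sum_(l <- s) l by rewrite big_seq sumr_ge0.
have ax : 0 <= a * x by rewrite mulr_ge0.
have aS : 0 <= a * \sum_(l <- s) l by rewrite mulr_ge0.
move=> h; have {}IH := IH ss0 ltac:(lra).
apply: (@le_trans _ _ ((1 - a * x) * (1 - a * \sum_(l <- s) l))); first by nra.
by rewrite ler_wpM2l//; lra.
Qed.

Lemma prod_le_expR lam (a : R) : (forall l, l \in lam -> 0 <= l) -> 0 <= a ->
  \prod_(l <- lam) (1 + a * l) <= expR (a * \sum_(l <- lam) l).
Proof.
move=> lam0 a0; rewrite mulr_sumr expR_sum; rewrite big_seq [leRHS]big_seq.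
apply: ler_prod => l /lam0 l0; rewrite expR_ge1Dx andbT.
by rewrite addr_ge0// mulr_ge0.
Qed.

(** Convexity of the exponential: the tangent bounds at [th * u], compared with the endpoints [u]
    and 0, are averaged with weights [th] and [1 - th]. *)
Lemma expR_chord (th u : R) : 0 <= th <= 1 -> expR (th * u) <= 1 + th * (expR u - 1).
Proof.
case/andP => t0 t1.
have h1 := expR_sub_le (th * u) u; have h2 := expR_sub_le (th * u) 0.
rewrite expR0 subr0 in h2.
have h3 := ler_wpM2l t0 h1.
have t1' : 0 <= 1 - th by lra.
by have := ler_wpM2l t1' h2; lra.
Qed.

(** By [expR_chord], [1 + t * l] is at least [1 + t * e] to the power [l / e], and these exponents
    add up to at least [K]. This is how small eigenvalues whose sum is not small force fast
    decay. *)
Lemma prod_ge_pow lam (e t : R) (K : nat) : 0 < e -> 0 <= t ->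
  (forall l, l \in lam -> 0 <= l <= e) -> K%:R * e <= \sum_(l <- lam) l ->
  (1 + t * e) ^+ K <= \prod_(l <- lam) (1 + t * l).
Proof.
move=> e0 t0 lame Ke.
have te : 0 < 1 + t * e by rewrite ltr_pwDl// mulr_ge0// ltW.
pose u := ln (1 + t * e); have uE : expR u = 1 + t * e by rewrite lnK.
have u0 : 0 <= u by rewrite ln_ge0// lerDl mulr_ge0// ltW.
rewrite -uE -expRM_natl.
apply: (@le_trans _ _ (expR (\sum_(l <- lam) (l / e * u)))).
  rewrite ler_expR -mulr_suml -mulr_suml ler_wpM2r//.
  by rewrite ler_pdivlMr.
rewrite expR_sum big_seq [leRHS]big_seq; apply: ler_prod => l /lame/andP[l0 le].
rewrite expR_ge0/=; apply: (le_trans (expR_chord _ _)).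
  by apply/andP; split; [exact: divr_ge0 l0 (ltW e0)|rewrite ler_pdivrMr// mul1r].
by rewrite uE le_eqVlt; apply/orP; left; apply/eqP; field; rewrite gt_eqF.
Qed.

End SequenceProducts.

(** * Exponential moments and Laplace decay of sums of squares *)

Section SumOfSquares.
Context d (T : measurableType d) (R : realType) (P : probability T R).
Variable N : nat -> {RV P >-> R}.
Hypothesis NG : iid_standard_gaussian N.
Local Notation Ex := (Ex P).
Local Notation Exle f c := (Order.le (Ex f) (EFin c)).
Local Notation Exge f c := (Order.le (EFin c) (Ex f)).

(** The lower bound on the Laplace transform at 1 caps the sum of the eigenvalues by [2 / c0 ^+ 2].
    At [t = c0 ^+ 2 / 8] the product of the [1 - 2 * t * l] is then at least 1/2, whatever the
    truncation level [L]; Fatou's lemma removes the truncation. *)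
Lemma sum_sqr_exp_moment (c0 : R) n (X : 'I_n -> T -> R) : 0 < c0 ->
  (forall i, in_first_chaos N (X i)) ->
  Exge (fun x => expR (- 1 * \sum_i X i x ^+ 2)) c0 ->
  Exle (fun x => expR (c0 ^+ 2 / 8 * \sum_i X i x ^+ 2)) 2.
Proof.
move=> c00 hX Ec; set t := c0 ^+ 2 / 8.
have t0 : 0 < t by rewrite divr_gt0// exprn_gt0.
pose Q x := \sum_i X i x ^+ 2.
have mX i : measurable_fun setT (X i) := (hX i).1.
have mQ : measurable_fun setT Q by apply: measurable_sum => i; mfun; exact: mX.
have trunc (L : R) : Exle (fun x => expR (t * Num.min (Q x) L)) 2.
  (* The first bound leaves the inverse root of [p] at least [c0 / 2]; the second keeps the
     truncation error at most 1/2, next to a main term of at most 3/2. *)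
  pose e := Num.min (c0 / 2) (2^-1 / (t * expR (t * L))).
  have tL0 : 0 < t * expR (t * L) by rewrite mulr_gt0// expR_gt0.
  have e0 : 0 < e by rewrite lt_min !divr_gt0// invr_gt0.
  have [lam [lam0 hA _ hC]] := chaos_laplace_approx NG hX e0.
  have := le_trans Ec (hA 1 ler01); rewrite lee_fin !mulr1 mul1r => h.
  set p := \prod_(l <- lam) _ in h.
  have pS : 1 + 2 * (\sum_(l <- lam) l) <= p by exact: prod_ge_1D.
  have S0 : 0 <= \sum_(l <- lam) l by rewrite big_seq sumr_ge0.
  have p0 : 0 < p by apply: lt_le_trans pS; rewrite ltr_pwDl// mulr_ge0.
  have ec : e <= c0 / 2 by rewrite ge_min lexx.
  have sp : c0 / 2 <= (Num.sqrt p)^-1 by lra.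
  have pc : p * c0 ^+ 2 <= 4.
    have sq0 : 0 < Num.sqrt p by rewrite sqrtr_gt0.
    have {}sp : Num.sqrt p * c0 <= 2.
      by have := ler_wpM2r (ltW sq0) sp; rewrite mulVf ?gt_eqF//; lra.
    have : (Num.sqrt p * c0) ^+ 2 <= 2 ^+ 2 by rewrite lerXn2r ?nnegrE// mulr_ge0// ltW.
    by rewrite exprMn sqr_sqrtr ?(ltW p0)//; lra.
  have tS : 2 * t * (\sum_(l <- lam) l) <= 1 / 2.
    have : (1 + 2 * (\sum_(l <- lam) l)) * c0 ^+ 2 <= 4.
      by apply: le_trans pc; rewrite ler_wpM2r// sqr_ge0.
    by have := sqr_ge0 c0; rewrite /t; lra.
  apply: (le_trans (hC t L (ltW t0) ltac:(lra))); rewrite lee_fin.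
  have hp : 1 / 2 <= \prod_(l <- lam) (1 - 2 * t * l).
    have t20 : 0 <= 2 * t by rewrite mulr_ge0// ltW.
    by apply: le_trans (prod_ge_1B lam0 t20 _); lra.
  set r := \prod_(l <- lam) _ in hp *.
  have sr : 2 / 3 <= Num.sqrt r.
    have -> : 2 / 3 = Num.sqrt ((2 / 3) ^+ 2) :> R by rewrite sqrtr_sqr ger0_norm.
    by rewrite ler_wsqrtr//; lra.
  have sr' : (Num.sqrt r)^-1 <= 3 / 2.
    by rewrite -[leRHS]invrK lef_pV2 ?posrE ?invr_gt0//; lra.
  have : t * expR (t * L) * e <= 1 / 2.
    by rewrite mulrC -ler_pdivlMr// ge_min mul1r lexx orbT.
  by lra.
apply: (@fatou_le _ _ _ P (fun n x => (expR (t * Num.min (Q x) n%:R))%:E)).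
- move=> k; apply/measurable_EFinP; apply: measurableT_comp => //.
  by apply: measurable_funM => //; exact: measurable_minr.
- by move=> k x; rewrite lee_fin expR_ge0.
- move=> x; apply: cvg_near_cst; near=> k.
  have -> : Num.min (Q x) k%:R = Q x; last by [].
  apply/min_idPl; apply: (@le_trans _ _ (Num.bound (Q x))%:R).
    by apply/ltW/archi_boundP; apply: sumr_ge0 => i _; exact: sqr_ge0.
  by rewrite ler_nat; near: k; exact: nbhs_infty_ge.
- by move=> k; exact: trunc.
Unshelve. all: by end_near. Qed.

(* A nearly deterministic [Q] has only small eigenvalues: [E e^{-Q}] and
   [E e^{-2Q}] bound [prod (1 + 2l)^2 / (1 + 4l)] by a number close to 1, and
   each factor is [1 + 4 l^2 / (1 + 4l)]. *)
Lemma sum_sqr_laplace_decay (c c' : R) (K : nat) : 0 < c ->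
  exists e eta : R, [/\ 0 < e, 0 < eta &
    forall n (X : 'I_n -> T -> R) (s : R), (forall i, in_first_chaos N (X i)) ->
      c <= s <= c' ->
      Exge (fun x => expR (- 1 * \sum_i X i x ^+ 2)) (expR (- s) - eta) ->
      Exle (fun x => expR (- 2 * \sum_i X i x ^+ 2)) (expR (- (2 * s)) + eta) ->
      forall t : R, 0 <= t ->
        Exle (fun x => expR (- t * \sum_i X i x ^+ 2)) ((1 + 2 * e * t) ^+ K)^-1].
Proof.
move=> c0.
(* Chosen so that [K.*2%:R * e <= c / 2]: the eigenvalue sum will be at least [c / 2], and the
   exponent [K.*2] becomes [K] under the square root. The terms [4 + c] also give [e <= 1] and
   [e <= c]. *)
pose e := c / (K.*2.*2%:R + 4 + c).
have D0 : 0 < K.*2.*2%:R + 4 + c by rewrite ltr_wpDl// ltr_wpDl.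
have e0 : 0 < e by rewrite divr_gt0.
have e1 : e <= 1 by rewrite ler_pdivrMr// mul1r ler_wpDl// addr_ge0.
have ec : e <= c.
  rewrite ler_pdivrMr// ler_peMr ?ltW//.
  by have : 0 <= K.*2.*2%:R :> R by []; lra.
have eK : K.*2%:R * e <= c / 2.
  rewrite mulrA ler_pdivrMr//.
  have -> : K.*2.*2%:R = 2 * K.*2%:R :> R by rewrite -[in LHS]muln2 natrM mulrC.
  have : 0 <= c / 2 * (4 + c) by rewrite mulr_ge0//; lra.
  by lra.
(* The tolerance for relative errors. An eigenvalue [l] above [e] would make
   [4 * l ^+ 2 / (1 + 4 * l)] at least [4 / 5 * e ^+ 2], that is [128 * kap], far more than such
   errors allow. *)
pose kap := e ^+ 2 / 160.
have kap0 : 0 < kap by rewrite divr_gt0// exprn_gt0.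
have kap1 : kap <= 1 / 160 by rewrite ler_wpM2r// expr_le1// ltW.
have kapc : 3 * kap <= c.
  rewrite /kap; have : e ^+ 2 <= e by rewrite expr2 ler_piMr// ltW.
  by lra.
(* [m] bounds [expR (- s)] from below over the whole range of [s], so the absolute error [eta] is at
   most [kap] times [expR (- s)] and [kap] times its square. *)
pose m := expR (- c'); have m0 : 0 < m by exact: expR_gt0.
pose eta := kap * m ^+ 2.
have eta0 : 0 < eta by rewrite mulr_gt0// exprn_gt0.
exists e, eta; split => // n X s hX /andP[cs sc'] E1 E2 t t0.
pose x := expR (- s); have x0 : 0 < x by exact: expR_gt0.
have mx : m <= x by rewrite ler_expR lerN2.
have x1 : x <= 1 by rewrite -expR0 ler_expR oppr_le0; lra.
have x2E : expR (- (2 * s)) = x ^+ 2.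
  by rewrite /x expr2 -expRD; congr expR; ring.
have m2 : m ^+ 2 <= x ^+ 2 by rewrite lerXn2r// nnegrE ltW.
have m2' : m ^+ 2 <= x.
  by apply: (le_trans m2); rewrite expr2 ler_piMr// ltW.
have etax2 : eta <= kap * x ^+ 2 by rewrite ler_wpM2l// ltW.
have etax : eta <= kap * x by rewrite ler_wpM2l// ltW.
(* The eigenvalues depend on the accuracy [dl], but the bound does so only through [t * dl]; [dl] is
   sent to 0 at the end. *)
have main (dl : R) : 0 < dl -> dl <= eta ->
    Exle (fun x => expR (- t * \sum_i X i x ^+ 2)) (((1 + 2 * e * t) ^+ K)^-1 + t * dl).
  move=> dl0 dle.
  have [lam [lam0 hA hB _]] := chaos_laplace_approx NG hX dl0.
  apply: (le_trans (hA t t0)); rewrite lee_fin lerD2r.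
  have h1 := le_trans E1 (hA 1 ler01); rewrite lee_fin mulr1 mul1r in h1.
  have h2 := hB 2 _ ltac:(lra) E2; rewrite x2E -/x in h2.
  have h1' : x - eta <= (Num.sqrt (\prod_(l <- lam) (1 + 2 * l)))^-1 + dl by exact: h1.
  have {h2}h2' : (Num.sqrt (\prod_(l <- lam) (1 + 4 * l)))^-1 <= x ^+ 2 + eta + 2 * dl.
    by move: h2; have -> : 2 * 2 = 4 :> R by ring.
  set p1 := \prod_(l <- lam) _ in h1'; set p2 := \prod_(l <- lam) _ in h2'.
  have S0 : 0 <= \sum_(l <- lam) l by rewrite big_seq sumr_ge0.
  have p1_gt0 : 0 < p1.
    apply: lt_le_trans (prod_ge_1D lam0 _); last by [].
    by rewrite ltr_pwDl// mulr_ge0.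
  have p2_gt0 : 0 < p2.
    apply: lt_le_trans (prod_ge_1D lam0 _); last by [].
    by rewrite ltr_pwDl// mulr_ge0.
  have s1 : 0 < Num.sqrt p1 by rewrite sqrtr_gt0.
  have s2 : 0 < Num.sqrt p2 by rewrite sqrtr_gt0.
  have A1 : x * (1 - 2 * kap) <= (Num.sqrt p1)^-1 by lra.
  have A2 : (Num.sqrt p2)^-1 <= x ^+ 2 * (1 + 3 * kap) by lra.
  (* [p2] is at most the exponential of 4 times the sum, while [A2] bounds its inverse root by
     nearly [expR (- (2 * c))]; the sum is thus at least [c - 3 / 2 * kap]. *)
  have sumc : c / 2 <= \sum_(l <- lam) l.
    have h : expR (- (2 * \sum_(l <- lam) l)) <= expR (- (2 * c) + 3 * kap).
      apply: (@le_trans _ _ (Num.sqrt p2)^-1).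
        rewrite expRN lef_pV2 ?posrE ?expR_gt0//.
        have -> : expR (2 * \sum_(l <- lam) l) = Num.sqrt (expR (4 * \sum_(l <- lam) l)).
          have -> : 4 * \sum_(l <- lam) l = 2 * (\sum_(l <- lam) l) + 2 * (\sum_(l <- lam) l) by ring.
          by rewrite expRD -expr2 sqrtr_sqr ger0_norm// expR_ge0.
        by rewrite ler_wsqrtr//; exact: prod_le_expR.
      apply: (le_trans A2); rewrite expRD ler_pM ?sqr_ge0//.
      - by lra.
      - by rewrite -x2E ler_expR lerN2 ler_pM2l.
      - exact: expR_ge1Dx.
    by move: h; rewrite ler_expR; lra.
  have lame l : l \in lam -> 0 <= l <= e.
    move=> llam; have l0 := lam0 l llam; rewrite l0/= leNgt; apply/negP => el.
    have prodl : (1 + 4 * l ^+ 2 / (1 + 4 * l)) * p2 <= p1 ^+ 2.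
      rewrite /p1 /p2 (big_rem l llam)/= [in leRHS](big_rem l llam)/= exprMn mulrA.
      have d0 : 0 < 1 + 4 * l by rewrite ltr_pwDl// mulr_ge0.
      have -> : (1 + 4 * l ^+ 2 / (1 + 4 * l)) * (1 + 4 * l) = (1 + 2 * l) ^+ 2.
        by field; rewrite gt_eqF.
      rewrite ler_wpM2l ?sqr_ge0// -prodrXl big_seq [leRHS]big_seq.
      apply: ler_prod => y /mem_rem/lam0 y0; rewrite addr_ge0 ?mulr_ge0//=.
      by have := sqr_ge0 y; lra.
    set F := 1 + _ in prodl.
    have k1 : 0 < 1 - 2 * kap by lra.
    have B1 : (x * (1 - 2 * kap)) ^+ 2 * p1 <= 1.
      have h : x * (1 - 2 * kap) * Num.sqrt p1 <= 1 by rewrite -ler_pdivlMr// mul1r.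
      have : (x * (1 - 2 * kap) * Num.sqrt p1) ^+ 2 <= 1 ^+ 2.
        by rewrite lerXn2r ?nnegrE ?mulr_ge0// ltW.
      by rewrite exprMn sqr_sqrtr ?expr1n// ltW.
    have B1' : ((x * (1 - 2 * kap)) ^+ 2 * p1) ^+ 2 <= 1.
      by rewrite expr_le1// mulr_ge0 ?sqr_ge0// ltW.
    have B2 : 1 <= (x ^+ 2 * (1 + 3 * kap)) ^+ 2 * p2.
      have h : 1 <= x ^+ 2 * (1 + 3 * kap) * Num.sqrt p2.
        by rewrite -ler_pdivrMr// mul1r.
      have : 1 ^+ 2 <= (x ^+ 2 * (1 + 3 * kap) * Num.sqrt p2) ^+ 2.
        by rewrite lerXn2r ?nnegrE// (le_trans ler01 h).
      by rewrite exprMn sqr_sqrtr ?expr1n// ltW.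
    have B3 : F * (1 - 2 * kap) ^+ 4 <= (1 + 3 * kap) ^+ 2.
      have xp : 0 < x ^+ 4 * p2 by rewrite mulr_gt0// exprn_gt0.
      rewrite -(ler_pM2r xp); apply: le_trans (le_trans B1' _); last first.
        by apply: (le_trans B2); rewrite le_eqVlt; apply/orP; left; apply/eqP; ring.
      have -> : F * (1 - 2 * kap) ^+ 4 * (x ^+ 4 * p2) =
        (x * (1 - 2 * kap)) ^+ 4 * (F * p2) by ring.
      have -> : ((x * (1 - 2 * kap)) ^+ 2 * p1) ^+ 2 = (x * (1 - 2 * kap)) ^+ 4 * p1 ^+ 2 by ring.
      by rewrite ler_wpM2l// exprn_ge0// mulr_ge0// ltW.
    have F1 : 1 + 128 * kap <= F.
      rewrite /F lerD2l ler_pdivlMr ?ltr_pwDl ?mulr_ge0// /kap.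
      have el2 : e ^+ 2 <= l ^+ 2 by rewrite lerXn2r ?nnegrE// ltW.
      have el3 : e ^+ 2 * l <= l ^+ 2.
        by rewrite [leRHS]expr2 ler_wpM2r// (le_trans _ (ltW el))// expr2 ler_piMr// ltW.
      by lra.
    have k4 : 1 - 8 * kap <= (1 - 2 * kap) ^+ 4.
      have k2 : 0 <= kap ^+ 2 := sqr_ge0 kap.
      have -> : (1 - 2 * kap) ^+ 4 = 1 - 8 * kap + kap ^+ 2 * (24 - 32 * kap + 16 * kap ^+ 2) by ring.
      by rewrite lerDl mulr_ge0//; lra.
    (* To first order the left side is [1 + 120 * kap] and the right side [1 + 6 * kap];
       [kap <= 1 / 160] keeps the quadratic terms below the gap, whence the contradiction. *)
    have : (1 + 128 * kap) * (1 - 8 * kap) <= (1 + 3 * kap) ^+ 2.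
      by apply: le_trans B3; apply: ler_pM => //; lra.
    have : kap * kap <= kap * (1 / 160) by rewrite ler_wpM2l// ltW.
    by rewrite expr2; lra.
  have pw := @prod_ge_pow _ lam e (2 * t) K.*2 e0 ltac:(lra) lame (le_trans eK sumc).
  have B0 : 0 < 1 + 2 * t * e by rewrite ltr_pwDl// mulr_ge0 ?(ltW e0)// mulr_ge0.
  have -> : 1 + 2 * e * t = 1 + 2 * t * e by ring.
  rewrite lef_pV2 ?posrE ?exprn_gt0 ?sqrtr_gt0//; last first.
    by apply: lt_le_trans pw; exact: exprn_gt0.
  have -> : (1 + 2 * t * e) ^+ K = Num.sqrt ((1 + 2 * t * e) ^+ K.*2).
    by rewrite -muln2 exprM sqrtr_sqr ger0_norm// exprn_ge0// ltW.
  by rewrite ler_wsqrtr.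
apply/lee_addgt0Pr => de de0.
have t1 : 0 < t + 1 by rewrite ltr_wpDl.
have h := main (Num.min eta (de / (t + 1))).
apply: (le_trans (h _ _)).
- by rewrite lt_min eta0 divr_gt0.
- by rewrite ge_min lexx.
rewrite -EFinD lee_fin lerD2l.
apply: (@le_trans _ _ ((t + 1) * (de / (t + 1)))).
  by rewrite ler_pM ?ge_min ?lexx ?orbT ?lerDl// le_min ltW//= divr_ge0// ltW.
by rewrite mulrC divfK// gt_eqF.
Qed.

End SumOfSquares.

(** * Entrywise distance of matrices and their quadratic forms *)

Section MatrixDistance.
Context {R : realFieldType}.

Definition mxdist p (A S : 'M[R]_p) : R := \sum_i \sum_j `|A i j - S i j|.

Lemma mxdist_ge0 p (A S : 'M[R]_p) : 0 <= mxdist A S.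
Proof. by apply: sumr_ge0 => i _; apply: sumr_ge0. Qed.

Lemma mxdist_ge p (A S : 'M[R]_p) i j : `|A i j - S i j| <= mxdist A S.
Proof.
rewrite /mxdist (bigD1 i)//= (bigD1 j)//= -addrA lerDl addr_ge0//; apply: sumr_ge0 => // k _.
exact: sumr_ge0.
Qed.

Lemma sqr_le_sum k (u : 'rV[R]_k) i : u 0 i ^+ 2 <= \sum_j u 0 j ^+ 2.
Proof. by rewrite (bigD1 i)//= lerDl sumr_ge0// => j _; exact: sqr_ge0. Qed.

Lemma normrM_le_sum k (u : 'rV[R]_k) i j : `|u 0 i| * `|u 0 j| <= \sum_l u 0 l ^+ 2.
Proof.
have hi := sqr_le_sum u i; have hj := sqr_le_sum u j.
rewrite -(real_normK (num_real (u 0 i))) in hi; rewrite -(real_normK (num_real (u 0 j))) in hj.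
by have := sqr_ge0 (`|u 0 i| - `|u 0 j|); nra.
Qed.

Lemma qform_dist p (A S : 'M[R]_p) u :
  `|qform A u - qform S u| <= (\sum_i u 0 i ^+ 2) * mxdist A S.
Proof.
rewrite !qformE -sumrB; apply: (le_trans (ler_norm_sum _ _ _)).
rewrite /mxdist mulr_sumr ler_sum// => i _; rewrite -sumrB.
apply: (le_trans (ler_norm_sum _ _ _)); rewrite mulr_sumr ler_sum// => j _.
have -> : u 0 i * A i j * u 0 j - u 0 i * S i j * u 0 j = u 0 i * u 0 j * (A i j - S i j) by ring.
by rewrite !normrM ler_wpM2r// normrM_le_sum.
Qed.

Lemma qform_le p (S : 'M[R]_p) u :
  `|qform S u| <= (\sum_i u 0 i ^+ 2) * \sum_i \sum_j `|S i j|.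
Proof.
have := qform_dist S 0 u; rewrite [qform 0 u]/qform mulmx0 mul0mx mxE subr0.
move=> /le_trans; apply; rewrite ler_wpM2l ?sumr_ge0// => [i _|]; first exact: sqr_ge0.
by apply: ler_sum => i _; apply: ler_sum => j _; rewrite mxE subr0.
Qed.

End MatrixDistance.

(** Exhibits the determinant as a polynomial in [x], which gives its continuity at 0. *)
Lemma det_addr_scalar_horner (R : realType) p (A : 'M[R]_p) (x : R) :
  \det (x%:M + A) = (char_poly (- A)).[x].
Proof.
rewrite /char_poly -horner_evalE -det_map_mx; congr (\det _).
apply/matrixP => i j; rewrite !mxE /= horner_evalE hornerD hornerN hornerC.
by rewrite opprK hornerMn hornerX.
Qed.

(** * Gram matrices of chaos families *)

Section GramFamily.
Context d (T : measurableType d) (R : realType) (P : probability T R).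
Variable N : nat -> {RV P >-> R}.
Local Notation Ex := (Ex P).
Local Notation Exle f c := (Order.le (Ex f) (EFin c)).

Lemma gramE n p (B : 'I_n -> 'I_p -> T -> R) x i j :
  gram B x i j = \sum_k B k i x * B k j x.
Proof. by rewrite /gram mxE; apply: eq_bigr => k _; rewrite !mxE. Qed.

Lemma gram_qform n p (B : 'I_n -> 'I_p -> T -> R) x u :
  qform (gram B x) u = \sum_i (\sum_j u 0 j * B i j x) ^+ 2.
Proof.
rewrite /gram qform_gram; apply: eq_bigr => i _; congr (_ ^+ 2).
by apply: eq_bigr => j _; rewrite mxE.
Qed.

Lemma in_first_chaos_lincomb p (a : 'I_p -> R) (X : 'I_p -> T -> R) :
  (forall j, in_first_chaos N (X j)) -> in_first_chaos N (fun x => \sum_j a j * X j x).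
Proof.
move=> hX; have mX j : measurable_fun setT (X j) := (hX j).1; split.
  by apply: measurable_sum => j; mfun; exact: mX.
move=> e e0; pose s := \sum_j a j ^+ 2.
have s0 : 0 <= s by apply: sumr_ge0 => j _; exact: sqr_ge0.
(* Cauchy-Schwarz costs the factor [s] and the sum over [j] the factor [p]; the added ones make the
   final inequality strict and the denominator positive. *)
have e'0 : 0 < e / ((s + 1) * p.+1%:R) by rewrite divr_gt0// mulr_gt0// ltr_wpDl.
have /choice[k /choice[b hb]] : forall j, exists k (b : nat -> R), forall K, (k <= K)%N ->
    Exle (fun x => (X j x - gcomb N K b x) ^+ 2) (e / ((s + 1) * p.+1%:R)).
  by move=> j; exact: chaos_approx.
pose K := \max_j k j; exists K, (fun i => \sum_j a j * b j i).
have EK j : Exle (fun x => (X j x - gcomb N K (b j) x) ^+ 2) (e / ((s + 1) * p.+1%:R)).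
  by apply: hb; exact: leq_bigmax.
have mg j := measurable_gcomb N K (b j).
have md j : measurable_fun setT (fun x => (X j x - gcomb N K (b j) x) ^+ 2).
  by apply: measurable_funX; apply: measurable_funB; [exact: mX|exact: mg].
have ES := Ex_sum_le md (fun j x => sqr_ge0 _) EK.
have E2 := @Ex_le_scale _ _ _ P (fun x => (\sum_j a j * X j x - \sum_(i < K) (\sum_j a j * b j i) * N i x) ^+ 2)
   _ s _ _ _ _ _ _ _ ES.
apply: (le_lt_trans (E2 _ _ _ _ _ _)) => //.
- apply: measurable_funX; apply: measurable_funB.
    by apply: measurable_sum => j; mfun; exact: mX.
  by apply: measurable_sum => i; mfun.
- by apply: measurable_sum => j; exact: md.
- by move=> x; exact: sqr_ge0.
- by move=> x; apply: sumr_ge0 => j _; exact: sqr_ge0.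
- move=> x; apply: le_trans (row_cauchy_schwarz _ _).
  rewrite le_eqVlt; apply/orP; left; apply/eqP; congr (_ ^+ 2).
  under [X in _ - X]eq_bigr do rewrite mulr_suml.
  rewrite exchange_big /= -sumrB; apply: eq_bigr => j _.
  rewrite mulrBr; congr (_ - _); rewrite /gcomb mulr_sumr.
  by apply: eq_bigr => i _; rewrite mulrA.
have -> : s * (e / ((s + 1) * p.+1%:R) *+ p) = e * (s / (s + 1) * (p%:R / p.+1%:R)).
  by rewrite -mulr_natr invfM; ring.
rewrite lte_fin gtr_pMr//.
have h1 : s / (s + 1) < 1 by rewrite ltr_pdivrMr ?mul1r ?ltrDl// ltr_wpDl.
have h1' : 0 <= s / (s + 1) by rewrite divr_ge0// addr_ge0.
have h2 : p%:R / p.+1%:R <= 1 :> R by rewrite ler_pdivrMr// mul1r ler_nat.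
have h2' : 0 <= p%:R / p.+1%:R :> R by rewrite divr_ge0.
by apply: le_lt_trans h1; rewrite ler_piMr.
Qed.

End GramFamily.

(** * Consequences of the convergence in probability *)

Section GramConvergence.
Context d (T : measurableType d) (R : realType) (P : probability T R).
Variable N : nat -> {RV P >-> R}.
Hypothesis NG : iid_standard_gaussian N.
Local Notation Ex := (Ex P).
Local Notation Exle f c := (Order.le (Ex f) (EFin c)).
Local Notation Exge f c := (Order.le (EFin c) (Ex f)).
Variables (p : nat) (r : nat -> nat).
Variable B : forall n, 'I_(r n) -> 'I_p -> T -> R.
Variable S : 'M[R]_p.
Arguments B n : clear implicits.
Hypothesis BN : forall n i j, in_first_chaos N (B n i j).
Hypothesis Su : S \in unitmx.
Hypothesis BS : forall (i j : 'I_p) (eps : R), 0 < eps ->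
  P [set x | eps <= `|gram (B n) x i j - S i j|] @[n --> \oo] --> 0%E.

Lemma measurable_gram n i j : measurable_fun setT (fun x => gram (B n) x i j).
Proof.
have mB k l : measurable_fun setT (B n k l) by have [] := @BN n k l.
rewrite (_ : (fun x => _) = (fun x => \sum_k B n k i x * B n k j x)).
  by apply: measurable_sum => k; apply: measurable_funM; exact: mB.
by apply/funext => x; rewrite gramE.
Qed.

Lemma measurable_set_ler (f : T -> R) (c : R) : measurable_fun setT f ->
  measurable [set x | c <= f x].
Proof.
move=> mf; rewrite (_ : [set x | _] = setT `&` f @^-1` `[c, +oo[%classic).
  exact: mf.
by rewrite setTI; apply/seteqP; split => x /=; rewrite in_itv/= andbT.
Qed.

Lemma Ex_indic (A : set T) : measurable A -> Ex (\1_A) = P A.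
Proof. by move=> mA; rewrite /Ex integral_indic// setIT. Qed.

Let D n x := mxdist (gram (B n) x) S.

Lemma measurable_mxdist n : measurable_fun setT (D n).
Proof.
apply: measurable_sum => i; apply: measurable_sum => j; apply: measurableT_comp => //.
by apply: measurable_funB => //; exact: measurable_gram.
Qed.

(** Union bound over the entries. Writing [p.+1] for [p] keeps the denominators positive and the
    comparison of [D n x] with [eps] strict. *)
Lemma gram_mxdist_small (eps eta : R) : 0 < eps -> 0 < eta ->
  \forall n \near \oo, (P [set x | (eps <= D n x)%R] <= eta%:E)%E.
Proof.
move=> eps0 eta0.
have p0 : 0 < p.+1%:R :> R by [].
pose eps' := eps / (p.+1%:R * p.+1%:R); pose eta' := eta / (p.+1%:R * p.+1%:R).
have eps'0 : 0 < eps' by rewrite divr_gt0// mulr_gt0.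
have eta'0 : 0 < eta' by rewrite divr_gt0// mulr_gt0.
have H : \forall n \near \oo, forall ij : 'I_p * 'I_p,
    (P [set x | (eps' <= `|gram (B n) x ij.1 ij.2 - S ij.1 ij.2|)%R] < eta'%:E)%E.
  apply: filter_forall => -[i j] /=.
  have e0' : (0 < eta'%:E)%E by rewrite lte_fin.
  have /= := @BS i j eps' eps'0 _ (open_ereal_lt' e0').
  exact.
apply: filterS H => n Hn.
have H i j : (P [set x | (eps' <= `|gram (B n) x i j - S i j|)%R] <= eta'%:E)%E := ltW (Hn (i, j)).
pose E i j := [set x | eps' <= `|gram (B n) x i j - S i j|].
have mabs i j : measurable_fun setT (fun x => `|gram (B n) x i j - S i j|).
  by apply: measurableT_comp => //; apply: measurable_funB => //; exact: measurable_gram.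
have mE i j : measurable (E i j) by apply: measurable_set_ler; exact: mabs.
rewrite -Ex_indic; last by apply: measurable_set_ler; exact: measurable_mxdist.
apply: (@le_trans _ _ (Ex (fun x => \sum_i \sum_j \1_(E i j) x))).
  apply: Ex_le.
  - by apply: measurable_indic; apply: measurable_set_ler; exact: measurable_mxdist.
  - by apply: measurable_sum => i; apply: measurable_sum => j; exact: measurable_indic.
  - by move=> x.
  move=> x; rewrite indicE; case: (boolP (x \in _)) => [|_]; last first.
    by apply: sumr_ge0 => i _; apply: sumr_ge0.
  rewrite inE /= => Dx.
  have [/existsP[i /existsP[j ij]]|] := boolP [exists i, exists j, eps' <= `|gram (B n) x i j - S i j|].
    rewrite (bigD1 i)//= (bigD1 j)//= indicE mem_set// -addrA lerDl.
    by rewrite addr_ge0//; apply: sumr_ge0 => // k _; apply: sumr_ge0.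
  rewrite negb_exists => /forallP H'.
  have : D n x <= eps' *+ p *+ p.
    rewrite /D /mxdist -[p in leRHS]card_ord -sumr_const ler_sum// => i _.
    rewrite -sumr_const ler_sum// => j _.
    by have := H' i; rewrite negb_exists => /forallP/(_ j); rewrite -ltNge => /ltW.
  move=> /(le_trans Dx); rewrite leNgt => /negP[].
  rewrite -[ltRHS](@divfK _ (p.+1%:R * p.+1%:R)) ?gt_eqF ?mulr_gt0// -/eps'.
  rewrite -mulrnA -[ltLHS]mulr_natr ltr_pM2l// -natrM ltr_nat.
  by rewrite ltn_mul.
apply: (@le_trans _ _ ((eta' *+ p) *+ p)%:E).
  apply: Ex_sum_le.
  - by move=> i; apply: measurable_sum => j; exact: measurable_indic.
  - by move=> i x; apply: sumr_ge0.
  move=> i; apply: Ex_sum_le => //.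
  - by move=> j; exact: measurable_indic.
  - by move=> j; rewrite Ex_indic//; exact: H.
rewrite lee_fin -[leRHS](@divfK _ (p.+1%:R * p.+1%:R)) ?gt_eqF ?mulr_gt0// -/eta'.
by rewrite -mulrnA -[leLHS]mulr_natr ler_pM2l// -natrM ler_nat leq_mul.
Qed.

(** An event of probability at least 1/2 has a point. Closed conditions on Gram matrices, namely
    symmetry and semidefiniteness, pass to [S] through such points. *)
Lemma gram_close_point (eps : R) : 0 < eps -> exists n x, D n x < eps.
Proof.
move=> eps0; have h2 : 0 < 2^-1 :> R by rewrite invr_gt0.
have [n Pn] := filter_ex (gram_mxdist_small eps0 h2).
apply: contrapT => /forallNP/(_ n)/forallNP hx; move: Pn.
rewrite (_ : [set x | _] = setT).
  by rewrite (@probability_setT _ _ _ P) lee_fin => h; have : 2^-1 < 1 :> R; lra.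
by apply/seteqP; split => // x _ /=; rewrite leNgt; apply/negP; exact: hx.
Qed.

Lemma gram_sym n x : (gram (B n) x)^T = gram (B n) x.
Proof. by rewrite /gram trmx_mul trmxK. Qed.

Lemma gram_psd n x u : 0 <= qform (gram (B n) x) u.
Proof. by rewrite gram_qform sumr_ge0// => i _; exact: sqr_ge0. Qed.

Lemma limit_sym : S^T = S.
Proof.
apply/matrixP => i j; rewrite mxE; apply/eqP; rewrite -subr_eq0 -normr_le0.
apply/ler_addgt0Pr => e e0; rewrite add0r; have e2 : 0 < e / 2 by rewrite divr_gt0.
have [n [x Dx]] := gram_close_point e2.
have h1 := le_lt_trans (mxdist_ge (gram (B n) x) S i j) Dx.
have h2 := le_lt_trans (mxdist_ge (gram (B n) x) S j i) Dx.
have E : gram (B n) x i j = gram (B n) x j i by rewrite -[in LHS]gram_sym mxE.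
rewrite -E in h2; have -> : S j i - S i j = (gram (B n) x i j - S i j) - (gram (B n) x i j - S j i) by ring.
by apply: (le_trans (ler_normB _ _)); lra.
Qed.

Lemma limit_psd u : 0 <= qform S u.
Proof.
rewrite -oppr_le0; apply/ler_addgt0Pr => e e0; rewrite add0r.
set s := \sum_i u 0 i ^+ 2; have s0 : 0 <= s by apply: sumr_ge0 => i _; exact: sqr_ge0.
have e2 : 0 < e / (s + 1) by rewrite divr_gt0// ltr_wpDl.
have [n [x Dx]] := gram_close_point e2.
have h := qform_dist (gram (B n) x) S u; have h0 := gram_psd n x u.
have : s * D n x <= e.
  apply: (@le_trans _ _ ((s + 1) * (e / (s + 1)))).
    by apply: ler_pM => //; [exact: mxdist_ge0|rewrite lerDl|exact: ltW].
  by rewrite mulrC divfK// gt_eqF// ltr_wpDl.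
by have := ler_norm (qform (gram (B n) x) u - qform S u); rewrite -/s -/(D n x) in h; lra.
Qed.

(** A symmetric, semidefinite, invertible form is definite, here quantitatively: the constants of
    [psd_coord_le] are summed over the coordinates, and [M^-1] bounds the form from below on unit
    vectors. *)
Lemma limit_posdef_bound : exists2 M : R, 0 < M &
  forall u : 'rV[R]_p, \sum_i u 0 i ^+ 2 <= M * qform S u.
Proof.
exists (1 + \sum_i (1 + qform S (row i (invmx S)))).
  by rewrite ltr_pwDl// sumr_ge0// => i _; rewrite addr_ge0// limit_psd.
move=> u; rewrite mulrDl mul1r; apply: ler_wpDl; first exact: limit_psd.
rewrite mulr_suml ler_sum// => i _.
exact: psd_coord_le limit_sym limit_psd Su u i.
Qed.

Lemma measurable_gram_qform n u : measurable_fun setT (fun x => qform (gram (B n) x) u).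
Proof.
rewrite (_ : (fun x => _) = (fun x => \sum_i \sum_j u 0 i * gram (B n) x i j * u 0 j)).
  apply: measurable_sum => i; apply: measurable_sum => j.
  by apply: measurable_funM => //; apply: measurable_funM => //; exact: measurable_gram.
by apply/funext => x; rewrite qformE.
Qed.

(** On a unit vector the two forms differ by at most [D n x], whatever [u] is, so one exceptional
    event of probability at most [eta / 2] serves all directions. Off it, the Lipschitz constant
    [t <= 2] costs at most [2 * (eta / 4)]. *)
Lemma gram_laplace_close (eta : R) : 0 < eta ->
  \forall n \near \oo, forall (u : 'rV[R]_p) (t : R), \sum_i u 0 i ^+ 2 = 1 -> 0 <= t <= 2 ->
    Exle (fun x => expR (- t * qform (gram (B n) x) u)) (expR (- t * qform S u) + eta) /\
    Exge (fun x => expR (- t * qform (gram (B n) x) u)) (expR (- t * qform S u) - eta).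
Proof.
move=> eta0; have e4 : 0 < eta / 4 by rewrite divr_gt0.
have e2 : 0 < eta / 2 by rewrite divr_gt0.
near=> n => u t u1 /andP[t0 t2].
have PD : (P [set x | (eta / 4 <= D n x)%R] <= (eta / 2)%:E)%E.
  by near: n; exact: gram_mxdist_small.
set E := [set x | _] in PD.
have mE : measurable E by apply: measurable_set_ler; exact: measurable_mxdist.
pose h x : R := eta / 2 + \1_E x.
have h0 x : 0 <= h x by rewrite addr_ge0// ltW.
have mh : measurable_fun setT h by apply: measurable_funD => //; exact: measurable_indic.
have Eh : Exle h eta.
  have -> : eta = 1 * (eta / 2) + 1 * (eta / 2) by field.
  apply: (Ex_le_lin2 (g := fun=> eta / 2) (h := \1_E)) => //.
  - by move=> _; exact: ltW.
  - by move=> x; rewrite !mul1r.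
  - by rewrite Ex_cst.
  - by rewrite Ex_indic.
have mf : measurable_fun setT (fun x => expR (- t * qform (gram (B n) x) u)).
  by apply: measurableT_comp => //; apply: measurable_funM => //; exact: measurable_gram_qform.
have pt (a b : R) x : 0 <= a -> 0 <= b -> `|a - b| <= D n x ->
    expR (- t * a) <= 1 * expR (- t * b) + 1 * h x.
  move=> a0 b0 ab; rewrite !mul1r /h indicE.
  case: (boolP (x \in E)) => [_|]; rewrite ?notin_setE /E /=.
    have : expR (- t * a) <= 1 by rewrite -expR0 ler_expR mulNr oppr_le0 mulr_ge0.
    by have := expR_ge0 (- t * b); lra.
  move=> /negP; rewrite -ltNge => Dx; rewrite addr0.
  apply: (le_trans (expRN_lipschitz t0 a0 b0)); rewrite mul1r lerD2l.
  apply: (@le_trans _ _ (2 * (eta / 4))); last by lra.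
  by apply: ler_pM => //; apply: (le_trans ab); exact: ltW.
have dist x : `|qform (gram (B n) x) u - qform S u| <= D n x.
  by have := qform_dist (gram (B n) x) S u; rewrite u1 mul1r.
split.
  rewrite -[expR (- t * qform S u)]mul1r -[X in _ + X]mul1r.
  apply: (Ex_le_lin2 (g := fun=> expR (- t * qform S u)) (h := h)) => //.
  - by move=> x; apply: pt => //; [exact: gram_psd|exact: limit_psd].
  - by rewrite Ex_cst.
set f := fun x => _ in mf *.
have Ef1 : (Ex f <= 1)%E.
  rewrite -(Ex_cst P 1); apply: Ex_le => // x; first exact: expR_ge0.
  by rewrite /f -expR0 ler_expR mulNr oppr_le0 mulr_ge0// gram_psd.
have Ef : Ex f \is a fin_num.
  rewrite ge0_fin_numE; last by apply: Ex_ge0 => x; exact: expR_ge0.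
  by apply: (le_lt_trans Ef1); rewrite ltry.
rewrite -(fineK Ef) lee_fin lerBlDr -lee_fin.
have -> : ((expR (- t * qform S u))%:E = Ex (fun=> expR (- t * qform S u)))%E by rewrite Ex_cst.
rewrite -[fine _]mul1r -[X in _ + X]mul1r.
apply: (Ex_le_lin2 (g := f) (h := h)) => //.
- by move=> x; exact: expR_ge0.
- by move=> x; apply: pt; [exact: limit_psd|exact: gram_psd|rewrite distrC].
- by rewrite fineK.
Unshelve. all: by end_near. Qed.

(** By homogeneity, a vector of squared norm [s] at the exponent 1/2 amounts to a unit vector at
    [t = s / 2]: the length of [u] becomes the Laplace parameter. [M^-1] and the entry sum of [S]
    bracket [qform S] on unit vectors, which makes the constants independent of the direction. *)
Lemma gram_laplace_decay : exists2 e : R, 0 < e &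
  \forall n \near \oo, forall u : 'rV[R]_p,
    Exle (fun x => expR (- (1 / 2) * qform (gram (B n) x) u)) (\prod_i (1 + e * u 0 i ^+ 2))^-1.
Proof.
have [M M0 hM] := limit_posdef_bound.
pose c := M^-1; have c0 : 0 < c by rewrite invr_gt0.
have [e [eta [e0 eta0 H]]] := sum_sqr_laplace_decay NG (\sum_i \sum_j `|S i j|) p c0.
exists e => //; near=> n => u.
set s := \sum_i u 0 i ^+ 2; have s0 : 0 <= s by apply: sumr_ge0 => i _; exact: sqr_ge0.
have pos i : 0 < 1 + e * u 0 i ^+ 2 by rewrite ltr_pwDl// mulr_ge0 ?sqr_ge0// ltW.
have prodle : \prod_i (1 + e * u 0 i ^+ 2) <= (1 + e * s) ^+ p.
  rewrite -[p in leRHS]card_ord -prodr_const; apply: ler_prod => i _.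
  by rewrite ltW//= lerD2l ler_wpM2l ?sqr_le_sum// ltW.
apply: (@le_trans _ _ (((1 + e * s) ^+ p)^-1)%:E); last first.
  rewrite lee_fin lef_pV2 ?posrE//; last by apply: prodr_gt0 => i _.
  by rewrite exprn_gt0// ltr_pwDl// mulr_ge0// ltW.
have [s_eq0|s_neq0] := eqVneq s 0.
  have -> : u = 0 by apply/eqP; rewrite -row_eq0_sum_sqr; apply/eqP.
  rewrite s_eq0 mulr0 addr0 expr1n invr1 -(Ex_cst P 1).
  rewrite (_ : (fun x => _) = (fun=> 1))//; apply/funext => x.
  by rewrite /qform mul0mx mul0mx mxE mulr0 expR0.
have sp : 0 < s by rewrite lt0r s_neq0.
have ss : 0 < Num.sqrt s by rewrite sqrtr_gt0.
pose v := (Num.sqrt s)^-1 *: u.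
have v1 : \sum_i v 0 i ^+ 2 = 1.
  rewrite (eq_bigr (fun i => s^-1 * u 0 i ^+ 2)); last first.
    by move=> i _; rewrite mxE exprMn exprVn sqr_sqrtr// ltW.
  by rewrite -mulr_sumr mulVf.
have uv : u = Num.sqrt s *: v by rewrite scalerA divff ?scale1r// gt_eqF.
have close : forall (u : 'rV[R]_p) (t : R), \sum_i u 0 i ^+ 2 = 1 -> 0 <= t <= 2 ->
    Exle (fun x => expR (- t * qform (gram (B n) x) u)) (expR (- t * qform S u) + eta) /\
    Exge (fun x => expR (- t * qform (gram (B n) x) u)) (expR (- t * qform S u) - eta).
  by near: n; exact: gram_laplace_close.
have qE x : qform (gram (B n) x) v = \sum_i (\sum_j v 0 j * B n i j x) ^+ 2 by exact: gram_qform.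
have quE x : qform (gram (B n) x) u = s * qform (gram (B n) x) v.
  by rewrite [in LHS]uv qformZv sqr_sqrtr// ltW.
have {}H := H _ (fun i x => \sum_j v 0 j * B n i j x) (qform S v).
have t2 : 0 <= s / 2 by rewrite divr_ge0.
have := H _ _ _ _ (s / 2) t2.
have -> : 2 * e * (s / 2) = e * s by field.
have -> : (fun x => expR (- (s / 2) * \sum_i (\sum_j v 0 j * B n i j x) ^+ 2)) =
    (fun x => expR (- (1 / 2) * qform (gram (B n) x) u)).
  by apply/funext => x; rewrite -qE quE; congr expR; field.
apply.
- by move=> i; apply: in_first_chaos_lincomb => // j; exact: BN.
- apply/andP; split.
    by have := hM v; rewrite v1 -ler_pdivrMl// mulr1.
  by apply: (le_trans (ler_norm _)); have := qform_le S v; rewrite v1 mul1r.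
- have := (close v 1 v1 ltac:(lra)).2; rewrite mulN1r.
  by under [X in Ex X]eq_fun do rewrite qE.
- have := (close v 2 v1 ltac:(lra)).1; rewrite mulNr.
  by under [X in Ex X]eq_fun do rewrite qE.
Unshelve. all: by end_near. Qed.

End GramConvergence.

(** * Determinants and the moment of order one half *)

Lemma measurable_det d (T : measurableType d) (R : realType) p (A : T -> 'M[R]_p) :
  (forall i j, measurable_fun setT (fun x => A x i j)) ->
  measurable_fun setT (fun x => \det (A x)).
Proof.
move=> mA; rewrite /determinant; apply: measurable_sum => s.
by apply: measurable_funM => //; apply: measurable_prod => i _; exact: mA.
Qed.

Lemma det_scalar_gram_gt0 (R : realType) n k (B : 'M[R]_(n, k)) (x : R) : 0 < x ->
  0 < \det (x%:M + B^T *m B).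
Proof.
move=> x0; have [lam [lam0 lamD _]] := gram_eigenvalues B.
have -> : x%:M + B^T *m B = x *: (1%:M + x^-1 *: (B^T *m B)).
  by rewrite scalerDr scalemx1 scalerA divff ?scale1r// gt_eqF.
rewrite detZ lamD mulr_gt0 ?exprn_gt0// big_seq prodr_gt0// => l /lam0 l0.
by rewrite ltr_pwDl// mulr_ge0// invr_ge0 ltW.
Qed.

Lemma cvg_det_scalar (R : realType) p (A : 'M[R]_p) :
  \det ((k.+1%:R^-1)%:M + A) @[k --> \oo] --> \det A.
Proof.
have -> : \det A = (char_poly (- A)).[0].
  by rewrite -det_addr_scalar_horner raddf0 add0r.
rewrite (_ : (fun k => _) = horner (char_poly (- A)) \o @harmonic R).
  by apply: (cvg_comp _ (horner (char_poly (- A)))); [exact: cvg_harmonic|exact: continuous_horner].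
by apply/funext => k /=; rewrite det_addr_scalar_horner.
Qed.

Lemma det_gram_ge0 (R : realType) n k (B : 'M[R]_(n, k)) : 0 <= \det (B^T *m B).
Proof.
apply: (cvgr_to_ge (@cvg_det_scalar R _ (B^T *m B))).
by apply: nearW => j; rewrite ltW// det_scalar_gram_gt0.
Qed.

(** At a singular matrix the regularised determinants tend to 0 and the limit is [+oo], the value
    chosen by [det_inv_pow]; Fatou's lemma thus applies at every sample point. *)
Lemma cvg_det_inv_pow_half (R : realType) n k (B : 'M[R]_(n, k)) :
  ((Num.sqrt (\det ((j.+1%:R^-1)%:M + B^T *m B)))^-1)%:E @[j --> \oo] -->
  det_inv_pow (1 / 2) (B^T *m B).
Proof.
set M := B^T *m B.
have d0 j : 0 < \det ((j.+1%:R^-1)%:M + M) by exact: det_scalar_gram_gt0.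
have sd : Num.sqrt (\det ((j.+1%:R^-1)%:M + M)) @[j --> \oo] --> Num.sqrt (\det M).
  apply: (cvg_comp (fun j : nat => \det ((j.+1%:R^-1)%:M + M)) (@Num.sqrt R)).
    exact: cvg_det_scalar.
  exact: sqrt_continuous.
rewrite /det_inv_pow; case: eqP => [dM|/eqP dM].
  rewrite dM sqrtr0 in sd; apply/cvgeryP.
  apply/(@cvgrVy _ _ _ _ (fun j : nat => Num.sqrt (\det ((j.+1%:R^-1)%:M + M)))) => //.
  by apply: nearW => j; rewrite sqrtr_gt0.
have dp : 0 < \det M by rewrite lt0r dM det_gram_ge0.
rewrite powRN -[1 / 2]/(1 * _) mul1r powR12_sqrt ?ltW//.
apply: cvg_EFin; first exact: nearW.
by apply: cvgV => //; rewrite gt_eqF// sqrtr_gt0.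
Qed.

Section HalfMoment.
Context d (T : measurableType d) (R : realType) (P : probability T R).
Variable N : nat -> {RV P >-> R}.
Hypothesis NG : iid_standard_gaussian N.
Variables (p : nat) (r : nat -> nat).
Variable B : forall n, 'I_(r n) -> 'I_p -> T -> R.
Variable S : 'M[R]_p.
Arguments B n : clear implicits.
Hypothesis BN : forall n i j, in_first_chaos N (B n i j).
Hypothesis Su : S \in unitmx.
Hypothesis BS : forall (i j : 'I_p) (eps : R), 0 < eps ->
  P [set x | eps <= `|gram (B n) x i j - S i j|] @[n --> \oo] --> 0%E.

(* The Gaussian integral turns [det(A + delta)^{-1/2}] into an average of
   [exp (- q_A(g) / 2)] over an independent copy [g] of the Gaussian vector;
   exchanging the two expectations leaves only Laplace transforms of [q_A(u)]
   at deterministic [u]. *)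
Lemma gram_det_half_moment : exists C : R,
  \forall n \near \oo, (\int[P]_x det_inv_pow (1 / 2) (gram (B n) x) <= C%:E)%E.
Proof.
have [e e0 dec] := gram_laplace_decay NG BN Su BS.
have [c c0 hc] := standard_normal_cauchy_lty e0.
exists (c ^+ p); apply: filterS dec => n dec.
have mA i j := measurable_gram BN n i j.
pose M k x := (k.+1%:R^-1 : R)%:M + gram (B n) x.
have mM k i j : measurable_fun setT (fun x => M k x i j).
  rewrite (_ : (fun x => _) = (fun x => ((k.+1%:R^-1 : R)%:M : 'M[R]_p) i j + gram (B n) x i j)).
    by apply: measurable_funD => //; exact: mA.
  by apply/funext => x; rewrite mxE.
apply: (@fatou_le _ _ _ P (fun k x => ((Num.sqrt (\det (M k x)))^-1)%:E)).
- move=> k; apply/measurable_EFinP; apply: measurable_fun_inv_gt0.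
    by move=> x; rewrite sqrtr_gt0 det_scalar_gram_gt0.
  have msqrt : measurable_fun setT (@Num.sqrt R).
    by apply: continuous_measurable_fun; exact: sqrt_continuous.
  apply: (measurableT_comp msqrt).
  by apply: measurable_det; exact: mM.
- by move=> k x; rewrite lee_fin invr_ge0 sqrtr_ge0.
- by move=> x; exact: cvg_det_inv_pow_half.
move=> k.
pose F (z : T * T) := (expR ((qform 1%:M (gvec N 0 p z.2) - qform (M k z.1) (gvec N 0 p z.2)) / 2))%:E.
have pM x : posdefmx (M k x).
  by have := @gram_posdef _ _ _ (\matrix_(i, j) B n i j x) (k.+1%:R^-1) 1;
    rewrite scale1r; apply.
have mF : measurable_fun setT F.
  have mg (i : 'I_p) : measurable_fun (setT : set (T * T)%type) (fun z => N (0 + i)%N z.2).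
    have mN : measurable_fun setT (N (0 + i)%N : T -> R) by exact: measurable_funP.
    exact: (measurableT_comp mN measurable_snd).
  apply/measurable_EFinP; apply: measurableT_comp => //; apply: measurable_funM => //.
  apply: measurable_funB; first exact: (measurable_qform _ mg).
  rewrite (_ : (fun z => _) = (fun z : T * T => \sum_(i < p) \sum_(j < p) N (0 + i)%N z.2 * M k z.1 i j * N (0 + j)%N z.2)).
    apply: measurable_sum => i; apply: measurable_sum => j.
    apply: measurable_funM => //; apply: measurable_funM => //.
    exact: (measurableT_comp (mM k i j) measurable_fst).
  by apply/funext => z; rewrite qformE; do 2 apply: eq_bigr => ? _; rewrite !mxE.
have F0 z : (0 <= F z)%E by rewrite lee_fin expR_ge0.
rewrite (eq_integral (fun x => \int[P]_y F (x, y))%E); last first.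
  by move=> x _; rewrite -(integral_gaussian_qform NG 0 (pM x)).
rewrite fubini_tonelli//.
(* The Gaussian integral contributes [expR (qform 1%:M u / 2)] and the Laplace bound the inverse
   product; together they are the product of [f] over the coordinates of [u]. *)
pose f (y : R) := expR (y ^+ 2 / 2) / (1 + e * y ^+ 2).
have f0 y : 0 <= f y.
  by rewrite divr_ge0 ?expR_ge0// addr_ge0// mulr_ge0 ?sqr_ge0// ltW.
have mf : measurable_fun setT f.
  apply: measurable_funM; first by apply: measurableT_comp => //; mfun.
  apply: measurable_fun_inv_gt0; last by mfun.
  by move=> y; rewrite ltr_pwDl// mulr_ge0 ?sqr_ge0// ltW.
apply: le_trans (integral_gaussian_prod NG mf f0 hc p 0).
apply: ge0_le_integral => //.
- by move=> y _; exact: integral_ge0.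
- exact: (@measurable_fun_fubini_tonelli_G _ _ _ _ _ P F).
- apply/measurable_EFinP; apply: measurable_prod => i _.
  by apply: (measurableT_comp mf).
move=> y _; set u := gvec N 0 p y.
have E1 : (\prod_(i < p) f (N (0 + i)%N y) = expR (qform 1%:M u / 2) * (\prod_i (1 + e * u 0 i ^+ 2))^-1)%R.
  rewrite qform1 mulr_suml expR_sum -prodfV -big_split /=.
  by apply: eq_bigr => i _; rewrite /f /u !mxE.
rewrite E1; apply: (@Ex_le_scale _ _ _ P (fun x => expR ((qform 1%:M u - qform (M k x) u) / 2))
  (fun x => expR (- (1 / 2) * qform (gram (B n) x) u))) => //.
- apply: measurableT_comp => //; apply: measurable_funM => //; apply: measurable_funB => //.
  rewrite (_ : (fun x => _) = (fun x => \sum_i \sum_j u 0 i * M k x i j * u 0 j)).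
    apply: measurable_sum => i; apply: measurable_sum => j.
    by apply: measurable_funM => //; apply: measurable_funM => //; exact: mM.
  by apply/funext => x; rewrite qformE.
- by apply: measurableT_comp => //; apply: measurable_funM => //; exact: (measurable_gram_qform BN).
- move=> x; rewrite -expRD ler_expR /M qformD -[(k.+1%:R^-1)%:M]scalemx1 qformZ.
  have : 0 <= k.+1%:R^-1 * qform 1%:M u.
    by rewrite mulr_ge0 ?invr_ge0// qform1 sumr_ge0// => i _; exact: sqr_ge0.
  have alg (a1 a2 a3 : R) : 0 <= a1 -> (a2 - (a1 + a3)) / 2 <= a2 / 2 + - (1 / 2) * a3 by lra.
  exact: alg.
Qed.

End HalfMoment.

(** * From the power one half to all powers of the determinant *)

Lemma det_inv_pow_ge0 (R : realType) p (q : R) (A : 'M[R]_p) : (0 <= det_inv_pow q A)%E.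
Proof. by rewrite /det_inv_pow; case: ifP => // _; rewrite lee_fin powR_ge0. Qed.

Lemma measurable_det_inv_pow d (T : measurableType d) (R : realType) p (q : R) (A : T -> 'M[R]_p) :
  (forall i j, measurable_fun setT (fun x => A x i j)) ->
  measurable_fun setT (fun x => det_inv_pow q (A x)).
Proof.
move=> mA; have mdet := measurable_det mA.
apply: measurable_fun_ifT.
- exact: measurable_fun_eqr.
- exact: measurable_cst.
- apply/measurable_EFinP.
  rewrite (_ : (fun x => _) = (@powR R ^~ (- q)) \o (fun x => \det (A x)))//.
  by apply: measurableT_comp => //; exact: measurable_powR.
Qed.

(** Meant for [A'] made of [m] diagonal copies of [A]. The constant 1 covers [\det A >= 1]; below 1
    the larger exponent [m / 2] dominates; a singular [A] gives [+oo] on both sides. *)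
Lemma det_inv_pow_le (R : realType) p p' (q : R) (m : nat) (A : 'M[R]_p) (A' : 'M[R]_p') :
  0 <= \det A -> \det A' = \det A ^+ m -> (0 < m)%N -> 0 <= q -> 2 * q <= m%:R ->
  (det_inv_pow q A <= 1 + det_inv_pow (1 / 2) A')%E.
Proof.
move=> dA0 dA' m0 q0 qm; rewrite /det_inv_pow dA' expf_eq0 m0 /=.
case: eqP => [_|/eqP dA]; first by rewrite addey.
have dp : 0 < \det A by rewrite lt0r dA.
rewrite -EFinD lee_fin.
have -> : (\det A ^+ m) `^ (- (1 / 2)) = \det A `^ (- (m%:R / 2)).
  by rewrite -powR_mulrn// -powRrM; congr (_ `^ _); ring.
have [d1|d1] := leP 1 (\det A).
  apply: ler_wpDr; first exact: powR_ge0.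
  by rewrite powRN invf_le1 ?powR_gt0// -[leLHS](powRr0 (\det A)) ler_powR.
apply: ler_wpDl => //; rewrite !powRN lef_pV2 ?posrE ?powR_gt0//.
apply: ger_powR; first by rewrite dp ltW.
by rewrite ler_pdivlMr// mulrC.
Qed.

Section AllMoments.
Context d (T : measurableType d) (R : realType) (P : probability T R).
Variable N : nat -> {RV P >-> R}.

Lemma in_first_chaos0 : in_first_chaos N (fun=> 0).
Proof.
split; first exact: measurable_cst.
move=> e e0; exists 0%N, (fun=> 0).
rewrite (eq_integral (fun=> 0%:E)); last first.
  by move=> x _; rewrite big_ord0 subrr expr0n.
by rewrite integral_cst_prob lte_fin.
Qed.

Definition gram_cvg (p : nat) (r : nat -> nat) (B : forall n, 'I_(r n) -> 'I_p -> T -> R)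
    (S : 'M[R]_p) : Prop :=
  forall (i j : 'I_p) (eps : R), 0 < eps ->
    P [set x | eps <= `|gram (B n) x i j - S i j|] @[n --> \oo] --> 0%E.

(* Block-diagonal copies: the determinant becomes its [m]-th power while the
   hypotheses on the family are preserved. *)
Lemma gram_copies (p : nat) (r : nat -> nat) (B : forall n, 'I_(r n) -> 'I_p -> T -> R)
    (S : 'M[R]_p) :
  (forall n i j, in_first_chaos N (B n i j)) -> S \in unitmx -> gram_cvg B S ->
  forall m, exists p' (r' : nat -> nat) (B' : forall n, 'I_(r' n) -> 'I_p' -> T -> R)
    (S' : 'M[R]_p'),
    [/\ forall n i j, in_first_chaos N (B' n i j), S' \in unitmx, gram_cvg B' S' &
      forall n x, \det (gram (B' n) x) = \det (gram (B n) x) ^+ m].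
Proof.
move=> BN Su BS; elim=> [|m [p' [r' [B' [S' [BN' Su' BS' dB']]]]]].
  (* Zero copies: the empty matrix, whose determinant is 1. *)
  exists 0%N, (fun=> 0%N), (fun n i j x => 0), 0; split.
  - by move=> n [].
  - by rewrite unitmxE det_mx00 unitr1.
  - by move=> [].
  - by move=> n x; rewrite det_mx00 expr0.
pose Bx n x : 'M[R]_(r n, p) := \matrix_(i, j) B n i j x.
pose Bx' n x : 'M[R]_(r' n, p') := \matrix_(i, j) B' n i j x.
pose B2 n (i : 'I_(r n + r' n)) (j : 'I_(p + p')) x : R := block_mx (Bx n x) 0 0 (Bx' n x) i j.
have gE n x : gram (B2 n) x = block_mx (gram (B n) x) 0 0 (gram (B' n) x).
  rewrite /gram (_ : \matrix_(i, j) _ = block_mx (Bx n x) 0 0 (Bx' n x)).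
    rewrite tr_block_mx mulmx_block !trmx0 !mulmx0 !mul0mx !addr0 add0r.
    by [].
  by apply/matrixP => i j; rewrite mxE.
have cst0 (f : nat -> \bar R) : (forall n, f n = 0%E) -> f n @[n --> \oo] --> 0%E.
  by move=> f0; rewrite (_ : f = (fun=> 0%E)); [exact: cvg_cst|exact/funext].
exists (p + p')%N, (fun n => (r n + r' n)%N), B2, (block_mx S 0 0 S'); split.
- move=> n i j; case: (split_ordP i) => i' ->; case: (split_ordP j) => j' ->.
  + rewrite (_ : B2 n _ _ = B n i' j'); first exact: BN.
    by apply/funext => x; rewrite /B2 block_mxEul mxE.
  + rewrite (_ : B2 n _ _ = (fun=> 0)); first exact: in_first_chaos0.
    by apply/funext => x; rewrite /B2 block_mxEur mxE.
  + rewrite (_ : B2 n _ _ = (fun=> 0)); first exact: in_first_chaos0.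
    by apply/funext => x; rewrite /B2 block_mxEdl mxE.
  + rewrite (_ : B2 n _ _ = B' n i' j'); first exact: BN'.
    by apply/funext => x; rewrite /B2 block_mxEdr mxE.
- by rewrite unitmxE det_ublock unitrM -!unitmxE Su.
- move=> i j eps eps0; case: (split_ordP i) => i' ->; case: (split_ordP j) => j' ->.
  + rewrite (_ : (fun n => _) = (fun n => P [set x | eps <= `|gram (B n) x i' j' - S i' j'|])).
      exact: BS.
    by apply/funext => n; congr (P _); apply/funext => x /=; rewrite gE !block_mxEul.
  + apply: cst0 => n; rewrite (_ : [set x | _] = set0) ?measure0//.
    apply/seteqP; split => // x /=.
    by rewrite gE !block_mxEur !mxE subrr normr0 leNgt eps0.
  + apply: cst0 => n; rewrite (_ : [set x | _] = set0) ?measure0//.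
    apply/seteqP; split => // x /=.
    by rewrite gE !block_mxEdl !mxE subrr normr0 leNgt eps0.
  + rewrite (_ : (fun n => _) = (fun n => P [set x | eps <= `|gram (B' n) x i' j' - S' i' j'|])).
      exact: BS'.
    by apply/funext => n; congr (P _); apply/funext => x /=; rewrite gE !block_mxEdr.
- by move=> n x; rewrite gE det_ublock dB' exprS.
Qed.

Lemma gram_det_moment (p : nat) (r : nat -> nat) (B : forall n, 'I_(r n) -> 'I_p -> T -> R)
    (S : 'M[R]_p) : iid_standard_gaussian N ->
  (forall n i j, in_first_chaos N (B n i j)) -> S \in unitmx -> gram_cvg B S ->
  forall q : R, 1 <= q -> exists (N0 : nat) (C : R), 0 < C /\
    forall n, (N0 <= n)%N -> (\int[P]_x det_inv_pow q (gram (B n) x) <= C%:E)%E.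
Proof.
move=> NG BN Su BS q q1; pose m := Num.bound (2 * q).
have qm : 2 * q < m%:R by apply: archi_boundP; lra.
have m0 : (0 < m)%N by rewrite -(ltr_nat R); lra.
have [p' [r' [B' [S' [BN' Su' BS' dB']]]]] := gram_copies BN Su BS m.
have [C [N0 _ hC]] := gram_det_half_moment NG BN' Su' BS'.
exists N0, (1 + `|C|); split; first by rewrite ltr_pwDl.
move=> n /hC /= {}hC.
have mB i j := measurable_gram BN n i j.
have mB' i j := measurable_gram BN' n i j.
apply: (@le_trans _ _ (\int[P]_x (1 + det_inv_pow (1 / 2) (gram (B' n) x))))%E.
  apply: ge0_le_integral => //.
  - by move=> x _; exact: det_inv_pow_ge0.
  - exact: measurable_det_inv_pow.
  - by apply: emeasurable_funD => //; exact: measurable_det_inv_pow.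
  - move=> x _; apply: (@det_inv_pow_le _ _ _ _ m) => //; last 2 first.
    + by lra.
    + exact: ltW.
    by rewrite /gram det_gram_ge0.
rewrite ge0_integralD//; last 2 first.
- by move=> x _; exact: det_inv_pow_ge0.
- exact: measurable_det_inv_pow.
rewrite integral_cst_prob EFinD leeD//.
by apply: (le_trans hC); rewrite lee_fin ler_norm.
Qed.

End AllMoments.

(** * Pointwise bounds on inverse matrices *)

Section InverseBounds.
Context {R : realType}.

Lemma det_norm_le k (M : 'M[R]_k) (Y : R) : (forall i j, `|M i j| <= Y) ->
  `|\det M| <= k`!%:R * Y ^+ k.
Proof.
move=> MY; apply: (le_trans (ler_norm_sum _ _ _)).
apply: (@le_trans _ _ (\sum_(s : 'S_k) Y ^+ k)).
  apply: ler_sum => s _; rewrite normrM normrX normrN1 expr1n mul1r normr_prod.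
  by rewrite -[k in leRHS]card_ord -prodr_const; apply: ler_prod => i _; rewrite normr_ge0 MY.
by rewrite sumr_const card_Sn mulr_natl.
Qed.

(** A cofactor is a minor of size [p.-1]; [1 <= Y] allows the uniform exponent [p]. *)
Lemma adj_norm_le p (A : 'M[R]_p) (Y : R) i j : 1 <= Y -> (forall i j, `|A i j| <= Y) ->
  `|\adj A i j| <= p`!%:R * Y ^+ p.
Proof.
move=> Y1 AY; rewrite mxE /cofactor normrM normrX normrN1 expr1n mul1r.
have /det_norm_le/le_trans : forall k l, `|row' j (col' i A) k l| <= Y.
  by move=> k l; rewrite !mxE.
apply; apply: ler_pM => //.
- by rewrite exprn_ge0// (le_trans ler01).
- by rewrite ler_nat; case: (p) => // k; rewrite factS leq_pmull.
- by rewrite ler_weXn2l// leq_pred.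
Qed.

Lemma invmx_entryE p (A : 'M[R]_p) i j : \det A != 0 ->
  invmx A i j = \adj A i j / \det A.
Proof. by move=> dA; rewrite /invmx unitmxE unitfE dA mxE mulrC. Qed.

Definition mxnorm1 p (A : 'M[R]_p) : R := \sum_i \sum_j `|A i j|.

Lemma mxnorm1_ge p (A : 'M[R]_p) i j : `|A i j| <= mxnorm1 A.
Proof.
by have := mxdist_ge A 0 i j; rewrite mxE subr0 => /le_trans; apply;
  apply: ler_sum => k _; apply: ler_sum => l _; rewrite mxE subr0.
Qed.

Lemma mxnorm1_ge0 p (A : 'M[R]_p) : 0 <= mxnorm1 A.
Proof. by apply: sumr_ge0 => i _; apply: sumr_ge0. Qed.

(** The second factor is one plus Cramer's bound for the entries of the inverse of [A], all entries
    of [A] being controlled by the trace. The product of the two factors lies above both the sum and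
    the product of the bounds for the two inverses. *)
Definition inv_bound p (S A : 'M[R]_p) : R :=
  (1 + mxnorm1 (invmx S)) * (1 + p`!%:R * (1 + \tr A) ^+ p / \det A).

(** Two estimates with one constant: the triangle inequality, for [A] far from [S], and [invmx A -
    invmx S = invmx A *m (S - A) *m invmx S], for [A] near [S]. *)
Lemma inv_dist_le p (S A : 'M[R]_p) i j : S \in unitmx -> 0 < \det A -> 0 <= \tr A ->
  (forall i j, `|A i j| <= \tr A) ->
  let w := `|invmx A i j - invmx S i j| in
  let U := inv_bound S A in [/\ 1 <= U, w <= U & w <= U * mxdist A S].
Proof.
move=> Su dA tA AtA w U.
set c := mxnorm1 (invmx S); set Z := p`!%:R * (1 + \tr A) ^+ p / \det A.
have c0 : 0 <= c := mxnorm1_ge0 _.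
have Y1 : 1 <= 1 + \tr A by rewrite lerDl.
have Z0 : 0 <= Z by rewrite divr_ge0 ?(ltW dA)// mulr_ge0// exprn_ge0// (le_trans ler01).
have AZ k l : `|invmx A k l| <= Z.
  rewrite invmx_entryE ?gt_eqF// normrM normfV (gtr0_norm dA) ler_pM2r ?invr_gt0//.
  by apply: adj_norm_le => // a b; apply: (le_trans (AtA a b)); rewrite lerDr.
have UE : U = (1 + c) * (1 + Z) by [].
have cZ0 : 0 <= c * Z by rewrite mulr_ge0.
split; rewrite UE.
- by nra.
- apply: (le_trans (ler_normB _ _)).
  by have := AZ i j; have := mxnorm1_ge (invmx S) i j; rewrite -/c; nra.
have Au : A \in unitmx by rewrite unitmxE unitfE gt_eqF.
have E : invmx A - invmx S = invmx A *m (S - A) *m invmx S.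
  by rewrite mulmxBr mulmxBl mulVmx// mul1mx -mulmxA mulmxV// mulmx1.
rewrite /w; have -> : invmx A i j - invmx S i j = (invmx A *m (S - A) *m invmx S) i j.
  by rewrite -E !mxE.
rewrite !mxE; apply: (le_trans (ler_norm_sum _ _ _)).
apply: (@le_trans _ _ (\sum_l \sum_k Z * `|A k l - S k l| * c)).
  apply: ler_sum => l _; rewrite mxE mulr_suml; apply: (le_trans (ler_norm_sum _ _ _)).
  apply: ler_sum => k _; rewrite !normrM !mxE distrC.
  by apply: ler_pM => //; [apply: ler_wpM2r|exact: mxnorm1_ge].
have -> : \sum_l \sum_k Z * `|A k l - S k l| * c = c * Z * mxdist A S.
  rewrite /mxdist exchange_big mulr_sumr; apply: eq_bigr => l _.
  by rewrite mulr_sumr; apply: eq_bigr => k _; ring.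
by apply: ler_wpM2r; [exact: mxdist_ge0|nra].
Qed.

(** From [1 + x <= expR x] at [x = t * y / M], raised to the power [M]. *)
Lemma pow_le_expR (M : nat) (t y : R) : 0 < t -> 0 <= y -> 
  y ^+ M <= (M%:R / t) ^+ M * expR (t * y).
Proof.
move=> t0 y0; case: M => [|M]; first by rewrite !expr0 mul1r -expR0 ler_expR mulr_ge0// ltW.
have M0 : 0 < M.+1%:R :> R by [].
have -> : y = M.+1%:R / t * (t * y / M.+1%:R) by field; rewrite !gt_eqF.
rewrite [in leLHS]exprMn ler_wpM2l ?exprn_ge0 ?divr_ge0 ?(ltW t0)//.
have -> : t * (M.+1%:R / t * (t * y / M.+1%:R)) = M.+1%:R * (t * y / M.+1%:R).
  by field; rewrite !gt_eqF.
rewrite expRM_natl; apply: lerXn2r; rewrite ?nnegrE ?expR_ge0//.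
  by rewrite divr_ge0// mulr_ge0// ltW.
by apply: le_trans (expR_ge1Dx _); rewrite lerDr.
Qed.

Lemma pow_1D_le (n : nat) (a : R) : 0 <= a -> (1 + a) ^+ n <= 2 ^+ n * (1 + a ^+ n).
Proof.
move=> a0; have [a1|a1] := leP a 1.
  apply: (@le_trans _ _ (2 ^+ n)).
    by apply: lerXn2r; rewrite ?nnegrE ?addr_ge0//; lra.
  by rewrite ler_peMr ?exprn_ge0// lerDl exprn_ge0.
apply: (@le_trans _ _ ((2 * a) ^+ n)).
  by apply: lerXn2r; rewrite ?nnegrE ?addr_ge0 ?mulr_ge0//; lra.
by rewrite exprMn ler_wpM2l ?exprn_ge0// lerDr.
Qed.

(** The trace and the determinant are separated by [a b <= a^2 + b^2], which doubles the exponent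
    [m.*2] to [m.*2.*2]; the power of the trace is then absorbed in an exponential. *)
Lemma inv_bound_pow_le p (S : 'M[R]_p) (m : nat) (t : R) : 0 < t ->
  exists2 K : R, 0 < K & forall A : 'M[R]_p, 0 < \det A -> 0 <= \tr A ->
    inv_bound S A ^+ m.*2 <= K * (expR (t * \tr A) + (\det A ^+ m.*2.*2)^-1).
Proof.
move=> t0; set c := mxnorm1 (invmx S); have c0 : 0 <= c := mxnorm1_ge0 _.
pose n := m.*2; pose M := (p * n.*2)%N.
pose K1 := ((1 + c) * p`!%:R) ^+ n * 2 ^+ n.*2.
have K1p : 0 < K1 by rewrite mulr_gt0// exprn_gt0// mulr_gt0 ?ltr_pwDl// ltr0n fact_gt0.
pose K2 := (M%:R / t) ^+ M * expR t.
have K20 : 0 <= K2 by rewrite mulr_ge0 ?expR_ge0// exprn_ge0// divr_ge0// ltW.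
exists (K1 * (1 + 2 * K2)); first by rewrite mulr_gt0// ltr_pwDl// mulr_ge0.
move=> A dA tA; set Y := 1 + \tr A; have Y1 : 1 <= Y by rewrite lerDl.
have Y0 : 0 <= Y by exact: le_trans Y1.
set z := (\det A)^-1; have z0 : 0 < z by rewrite invr_gt0.
have YM : Y ^+ M <= K2 * expR (t * \tr A).
  apply: (le_trans (pow_le_expR M t0 Y0)).
  by rewrite /K2 -mulrA ler_wpM2l ?exprn_ge0 ?divr_ge0 ?(ltW t0)// -expRD /Y mulrDr mulr1.
have f1 : 1 <= p`!%:R :> R by rewrite ler1n fact_gt0.
have Yp1 : 1 <= Y ^+ p by exact: exprn_ege1.
have b1 : inv_bound S A <= (1 + c) * p`!%:R * (Y ^+ p * (1 + z)).
  have -> : (1 + c) * p`!%:R * (Y ^+ p * (1 + z)) =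
    (1 + c) * (p`!%:R * Y ^+ p + p`!%:R * Y ^+ p * z) by ring.
  by rewrite /inv_bound -/c -/Y -/z ler_wpM2l ?addr_ge0// lerD2r mulr_ege1.
have U0 : 0 <= inv_bound S A.
  apply: mulr_ge0; first exact: addr_ge0.
  apply: addr_ge0 => //; apply: mulr_ge0; last exact: ltW.
  by apply: mulr_ge0 => //; exact: exprn_ge0.
apply: (@le_trans _ _ (((1 + c) * p`!%:R * (Y ^+ p * (1 + z))) ^+ n)).
  by apply: lerXn2r; rewrite ?nnegrE// (le_trans U0).
rewrite exprMn [X in _ * X <= _]exprMn /K1 -!mulrA ler_wpM2l ?exprn_ge0//.
  by rewrite mulr_ge0// addr_ge0.
set a := (Y ^+ p) ^+ n; set b := (1 + z) ^+ n.
have ab : a * b <= a ^+ 2 + b ^+ 2.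
  by have := sqr_ge0 (a - b); have := sqr_ge0 a; have := sqr_ge0 b; nra.
have aE : a ^+ 2 = Y ^+ M by rewrite /a -!exprM muln2.
have bE : b ^+ 2 <= 2 ^+ n.*2 * (1 + (\det A ^+ n.*2)^-1).
  rewrite /b -exprM muln2; apply: (le_trans (pow_1D_le _ (ltW z0))).
  by rewrite /z exprVn.
have e1 : 1 <= expR (t * \tr A) by rewrite -expR0 ler_expR mulr_ge0// ltW.
set x := expR _ in YM e1 *; set y := (\det A ^+ _)^-1 in bE *.
have y0 : 0 <= y by rewrite invr_ge0 exprn_ge0// ltW.
have T1 : 1 <= 2 ^+ n.*2 :> R by rewrite exprn_ege1// ler1n.
set T := 2 ^+ n.*2 in bE T1 *.
have p1 : 0 <= T * (x - 1) by rewrite mulr_ge0 ?subr_ge0// (le_trans ler01).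
have x0 : 0 <= x by exact: le_trans e1.
have T0 : 0 <= T by exact: le_trans T1.
have p2 : 0 <= (T - 1) * (K2 * x) by rewrite mulr_ge0 ?subr_ge0// mulr_ge0.
have p3 : 0 <= T * (K2 * y) := mulr_ge0 T0 (mulr_ge0 K20 y0).
have p4 : 0 <= T * (K2 * x) := mulr_ge0 T0 (mulr_ge0 K20 x0).
rewrite aE in ab.
have -> : T * ((1 + 2 * K2) * (x + y)) = T * x + T * y + 2 * (T * (K2 * x)) + 2 * (T * (K2 * y)) by ring.
apply: (le_trans ab); apply: (le_trans (lerD YM bE)).
by lra.
Qed.

End InverseBounds.

(** * Convergence of the inverses in L^q *)

Section InverseConvergence.
Context d (T : measurableType d) (R : realType) (P : probability T R).
Variable N : nat -> {RV P >-> R}.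
Hypothesis NG : iid_standard_gaussian N.
Local Notation Ex := (Ex P).
Local Notation Exle f c := (Order.le (Ex f) (EFin c)).

Lemma gram_trace n p (B : 'I_n -> 'I_p -> T -> R) x :
  \tr (gram B x) = \sum_(k : 'I_n * 'I_p) B k.1 k.2 x ^+ 2.
Proof.
rewrite /mxtrace -(pair_big xpredT xpredT (fun i j => B i j x ^+ 2)) exchange_big /=.
by apply: eq_bigr => j _; rewrite gramE; apply: eq_bigr => k _; rewrite expr2.
Qed.

Lemma gram_trace_ge0 n p (B : 'I_n -> 'I_p -> T -> R) x : 0 <= \tr (gram B x).
Proof. by rewrite gram_trace sumr_ge0// => k _; exact: sqr_ge0. Qed.

(** [2 |x y| <= x^2 + y^2], summed over the rows, compares an entry with two diagonal ones, each at
    most the trace. *)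
Lemma gram_le_trace n p (B : 'I_n -> 'I_p -> T -> R) x i j :
  `|gram B x i j| <= \tr (gram B x).
Proof.
have diag k : 0 <= gram B x k k.
  by rewrite gramE sumr_ge0// => l _; rewrite -expr2; exact: sqr_ge0.
have le_tr k : gram B x k k <= \tr (gram B x).
  by rewrite /mxtrace (bigD1 k)//= lerDl sumr_ge0.
have h : 2 * `|gram B x i j| <= gram B x i i + gram B x j j.
  rewrite !gramE -big_split /=; apply: (@le_trans _ _ (2 * \sum_k `|B k i x * B k j x|)).
    by rewrite ler_wpM2l// ler_norm_sum.
  rewrite mulr_sumr ler_sum// => k _; rewrite normrM -!expr2.
  rewrite -(real_normK (num_real (B k i x))) -(real_normK (num_real (B k j x))).
  by have := sqr_ge0 (`|B k i x| - `|B k j x|); nra.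
by have := le_tr i; have := le_tr j; lra.
Qed.

Variables (p : nat) (r : nat -> nat).
Variable B : forall n, 'I_(r n) -> 'I_p -> T -> R.
Variable S : 'M[R]_p.
Arguments B n : clear implicits.
Hypothesis BN : forall n i j, in_first_chaos N (B n i j).
Hypothesis Su : S \in unitmx.
Hypothesis BS : gram_cvg P B S.

Lemma measurable_gram_trace n : measurable_fun setT (fun x => \tr (gram (B n) x)).
Proof. by apply: measurable_sum => i; exact: measurable_gram. Qed.

(** The trace is itself a sum of squares of chaos elements, over all entries of [B n]. With
    probability at least 1/2 it is at most [\tr S + 1], whence the lower bound [c0] on its Laplace
    transform at 1. *)
Lemma gram_trace_exp_moment : exists2 t : R, 0 < t &
  \forall n \near \oo, Exle (fun x => expR (t * \tr (gram (B n) x))) 2.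
Proof.
pose c0 := expR (- (\tr S + 1)) / 2.
have c00 : 0 < c0 by rewrite divr_gt0// expR_gt0.
exists (c0 ^+ 2 / 8); first by rewrite divr_gt0// exprn_gt0.
have h2 : 0 < 2^-1 :> R by rewrite invr_gt0.
apply: filterS (gram_mxdist_small BN BS ltr01 h2) => n; set E := [set x | _] => PE.
have mtr := measurable_gram_trace n.
have mD : measurable E by apply: measurable_set_ler; exact: measurable_mxdist.
pose X (k : 'I_#|{: 'I_(r n) * 'I_p}|) := B n (enum_val k).1 (enum_val k).2.
have trE x : \tr (gram (B n) x) = \sum_k X k x ^+ 2.
  by rewrite gram_trace -(big_enum_val (fun k => B n k.1 k.2 x ^+ 2)).
rewrite (_ : (fun x => _) = (fun x => expR (c0 ^+ 2 / 8 * \sum_k X k x ^+ 2))); last first.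
  by apply/funext => x; rewrite trE.
apply: (sum_sqr_exp_moment NG c00); first by move=> k; exact: BN.
rewrite (_ : (fun x => _) = (fun x => expR (- 1 * \tr (gram (B n) x)))); last first.
  by apply/funext => x; rewrite trE.
set f := fun x => _.
have mf : measurable_fun setT f by apply: measurableT_comp => //; exact: measurable_funM.
have f0 x : 0 <= f x by exact: expR_ge0.
have Ef1 : (Ex f <= 1)%E.
  rewrite -(Ex_cst P 1); apply: Ex_le => // x.
  by rewrite /f -[leRHS]expR0 ler_expR mulN1r oppr_le0 gram_trace_ge0.
have Ef : Ex f \is a fin_num.
  rewrite ge0_fin_numE; last exact: Ex_ge0.
  by apply: (le_lt_trans Ef1); rewrite ltry.
rewrite -(fineK Ef) lee_fin.
have key : Exle (fun=> 1) (expR (\tr S + 1) * fine (Ex f) + 1 * 2^-1).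
  apply: (Ex_le_lin2 (g := f) (h := \1_E)) => //.
  - move=> x; rewrite mul1r indicE; case: (boolP (x \in E)) => xE.
      by rewrite lerDr mulr_ge0// expR_ge0.
    rewrite addr0 /f -expRD -[leLHS]expR0 ler_expR.
    move: xE; rewrite notin_setE /E /= => /negP; rewrite -ltNge => D1.
    have : \tr (gram (B n) x) - \tr S <= mxdist (gram (B n) x) S.
      rewrite -raddfB /= /mxtrace /mxdist ler_sum// => i _.
      rewrite (bigD1 i)//= !mxE; apply: (le_trans (ler_norm _)).
      by rewrite lerDl sumr_ge0.
    by lra.
  - by rewrite fineK.
  - by rewrite Ex_indic.
rewrite Ex_cst lee_fin mul1r in key.
rewrite /c0 expRN mulrC -ler_pdivlMl ?invr_gt0 ?expR_gt0// invrK.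
by rewrite -[leLHS]mul1r ler_pdivrMr ?expR_gt0//; lra.
Qed.

(** [invmx] returns a singular matrix unchanged, hence the case distinction; elsewhere the entry is
    a cofactor over the determinant. *)
Lemma measurable_gram_inv n i j : measurable_fun setT (fun x => invmx (gram (B n) x) i j).
Proof.
have mg k l := measurable_gram BN n k l.
rewrite (_ : (fun x => _) = (fun x => if \det (gram (B n) x) == 0 then gram (B n) x i j else
    \det (gram (B n) x) `^ (-1) * ((-1) ^+ (j + i) * \det (row' j (col' i (gram (B n) x)))))).
  apply: measurable_fun_ifT.
  - by apply: measurable_fun_eqr => //; exact: measurable_det.
  - exact: mg.
  - apply: measurable_funM.
      rewrite (_ : (fun x => _) = (@powR R ^~ (-1)) \o (fun x => \det (gram (B n) x)))//.
      by apply: measurableT_comp; [exact: measurable_powR|exact: measurable_det].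
    apply: measurable_funM => //; apply: measurable_det => k l.
    rewrite (_ : (fun x => _) = (fun x => gram (B n) x (lift j k) (lift i l))); first exact: mg.
    by apply/funext => x; rewrite !mxE.
apply/funext => x; rewrite /invmx unitmxE unitfE; case: eqP => //= _.
by rewrite !mxE powR_inv1// /gram det_gram_ge0.
Qed.

(** Let [a = U ^+ m], where [U] is [inv_bound]. Within distance [e] of [S] the difference of
    inverses is at most [U * e], and its power [q] at most [a * e <= e * a ^+ 2]. Farther away it is
    at most [U], and [a <= e * a ^+ 2 + e^-1] by Young's inequality. [inv_bound_pow_le] bounds
    [a ^+ 2]; a singular matrix makes the right side [+oo]. *)
Lemma gram_inv_dominated (q t : R) i j : 1 <= q -> 0 < t -> exists (K : R) (m : nat),
  [/\ 0 < K, (0 < m)%N & forall n x (e : R), 0 < e -> e <= 1 ->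
    ((`|invmx (gram (B n) x) i j - invmx S i j| `^ q)%:E <=
      (2 * e * K)%:E * ((expR (t * \tr (gram (B n) x)))%:E + det_inv_pow m%:R (gram (B n) x))
      + (e^-1 * \1_[set x | (e <= mxdist (gram (B n) x) S)%R] x)%:E)%E].
Proof.
move=> q1 t0; pose m := Num.bound q.
have qm : q < m%:R by apply: archi_boundP; lra.
have m0 : (0 < m)%N by rewrite -(ltr_nat R); lra.
have [K K0 hK] := inv_bound_pow_le S m t0.
exists K, m.*2.*2; split; [exact: K0|by rewrite !double_gt0|].
move=> n x e e0 e1; set A := gram (B n) x; set ind := e^-1 * _.
have eK : 0 < 2 * e * K by rewrite !mulr_gt0.
have tA : 0 <= \tr A := gram_trace_ge0 _ _.
rewrite /det_inv_pow; case: eqP => [_|/eqP dA].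
  by rewrite addey// gt0_muley ?lte_fin// addye// leey.
have dp : 0 < \det A by rewrite lt0r dA /A /gram det_gram_ge0.
rewrite powRN powR_mulrn ?(ltW dp)//.
change ((`|invmx A i j - invmx S i j| `^ q)%:E <=
  (2 * e * K * (expR (t * \tr A) + (\det A ^+ m.*2.*2)^-1) + ind)%:E)%E.
rewrite lee_fin.
have := hK A dp tA; set G := expR _ + _ => UG.
have [U1 wU wUD] := inv_dist_le i j Su dp tA (@gram_le_trace _ _ _ _).
set w := `|_| in wU wUD *; set U := inv_bound S A in U1 wU wUD UG.
have U0 : 0 < U by exact: lt_le_trans U1.
have q0 : 0 <= q by lra.
have w0 : 0 <= w by exact: normr_ge0.
have Uqm : U `^ q <= U ^+ m.
  by rewrite -powR_mulrn ?(ltW U0)// ler_powR// ltW.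
have Um1 : 1 <= U ^+ m by exact: exprn_ege1.
have U2 : U ^+ m.*2 = U ^+ m * U ^+ m by rewrite -addnn exprD.
have KG : 2 * e * K * G = 2 * e * (K * G) by ring.
rewrite KG; set a := U ^+ m in Uqm Um1 U2.
rewrite U2 in UG.
have eG : e * (a * a) <= e * (K * G) by rewrite ler_wpM2l// ltW.
have a2 : 0 <= e * (a * a) by rewrite mulr_ge0 ?(ltW e0)// mulr_ge0// (le_trans ler01).
rewrite /ind indicE; case: (boolP (x \in _)) => xE.
  rewrite mulr1; have wq : w `^ q <= a.
    by apply: le_trans Uqm; apply: ge0_ler_powR; rewrite ?nnegrE// ltW.
  have : a <= e * (a * a) + e^-1.
    have h : 0 <= e^-1 * (e * a - 1) ^+ 2 by rewrite mulr_ge0 ?sqr_ge0// invr_ge0 ltW.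
    have E : e^-1 * (e * a - 1) ^+ 2 = e * (a * a) - 2 * a + e^-1 by field; rewrite gt_eqF.
    by rewrite E in h; lra.
  by lra.
rewrite mulr0 addr0; move: xE; rewrite notin_setE /= => /negP; rewrite -ltNge => De.
have wUe : w <= U * e by apply: (le_trans wUD); rewrite ler_wpM2l ?ltW.
have : w `^ q <= a * e.
  apply: (@le_trans _ _ ((U * e) `^ q)).
    have Ue0 : 0 <= U * e := mulr_ge0 (ltW U0) (ltW e0).
    by apply: ge0_ler_powR; rewrite ?nnegrE.
  rewrite powRM ?(ltW U0) ?(ltW e0)//; apply: ler_pM => //; rewrite ?powR_ge0//.
  by apply: ge1r_powR => //; rewrite e0.
have : a * e <= e * (a * a) by rewrite mulrC ler_wpM2l ?(ltW e0)// ler_peMr// (le_trans ler01).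
by lra.
Qed.

Lemma cvge0_le (f : nat -> \bar R) : (forall n, (0 <= f n)%E) ->
  (forall e : R, 0 < e -> \forall n \near \oo, (f n <= e%:E)%E) -> f n @[n --> \oo] --> 0%E.
Proof.
move=> f0 fe; have fin : \forall n \near \oo, f n \is a fin_num.
  apply: filterS (fe 1 ltr01) => n fn; rewrite ge0_fin_numE//.
  by apply: (le_lt_trans fn); rewrite ltry.
apply/fine_cvgP; split => //; apply/cvgrPdist_le => e e0; near=> n.
have fn : f n \is a fin_num by near: n.
have fne : (f n <= e%:E)%E by near: n; exact: fe.
rewrite /= sub0r normrN ger0_norm ?fine_ge0//.
by rewrite -lee_fin fineK.
Unshelve. all: by end_near. Qed.

Lemma gram_inv_cvg (q : R) i j : 1 <= q ->
  (\int[P]_x ((`|invmx (gram (B n) x) i j - invmx S i j|) `^ q)%:E)%E @[n --> \oo] --> 0%E.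
Proof.
move=> q1; have [t t0 Etr] := gram_trace_exp_moment.
have [K [m [K0 m0 dom]]] := gram_inv_dominated i j q1 t0.
have m1 : 1 <= m%:R :> R by rewrite ler1n.
have [N0 [C [C0 hC]]] := gram_det_moment NG BN Su BS m1.
apply: cvge0_le => [n|del del0].
  by apply: integral_ge0 => x _; rewrite lee_fin powR_ge0.
(* Here 2 bounds the exponential moment and [C] the determinant moment. [e] is fixed before [n]; the
   probability of being [e]-far from [S] is then made at most [e * (del / 2)], which absorbs the
   factor [e^-1]. *)
pose L := 2 * K * (2 + C) + 1.
have L0 : 0 < L by rewrite ltr_wpDl// !mulr_ge0// ?(ltW K0)// addr_ge0// ltW.
pose e := Num.min 1 (del / 2 / L).
have e0 : 0 < e by rewrite lt_min ltr01 !divr_gt0.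
have e1 : e <= 1 by rewrite ge_min lexx.
have eL : e * L <= del / 2 by rewrite -ler_pdivlMr// ge_min lexx orbT.
have ed : 0 < e * (del / 2) by rewrite mulr_gt0// divr_gt0.
near=> n.
have hn : Exle (fun x => expR (t * \tr (gram (B n) x))) 2 by near: n; exact: Etr.
have {}hC : (\int[P]_x det_inv_pow m%:R (gram (B n) x) <= C%:E)%E.
  by apply: hC; near: n; exact: nbhs_infty_ge.
have PE : (P [set x | (e <= mxdist (gram (B n) x) S)%R] <= (e * (del / 2))%:E)%E.
  by near: n; exact: (gram_mxdist_small BN BS).
set E := [set x | _] in PE.
have mE : measurable E by apply: measurable_set_ler; exact: measurable_mxdist.
have mtr := measurable_gram_trace n.
have mtrE : measurable_fun setT (fun x => (expR (t * \tr (gram (B n) x)))%:E).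
  by apply/measurable_EFinP; apply: measurableT_comp => //; exact: measurable_funM.
have mdet : measurable_fun setT (fun x => det_inv_pow m%:R (gram (B n) x)).
  by apply: measurable_det_inv_pow => k l; exact: measurable_gram.
have mind : measurable_fun setT (fun x => (e^-1 * \1_E x)%:E).
  by apply/measurable_EFinP; apply: measurable_funM => //; exact: measurable_indic.
have eK0 : 0 <= 2 * e * K by rewrite !mulr_ge0 ?(ltW e0) ?(ltW K0).
have sum0 x : (0 <= (expR (t * \tr (gram (B n) x)))%:E + det_inv_pow m%:R (gram (B n) x))%E.
  by rewrite adde_ge0 ?lee_fin ?expR_ge0// det_inv_pow_ge0.
have ei0 : 0 <= e^-1 by rewrite invr_ge0 ltW.
apply: (@le_trans _ _ (\int[P]_x ((2 * e * K)%:E *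
    ((expR (t * \tr (gram (B n) x)))%:E + det_inv_pow m%:R (gram (B n) x)) + (e^-1 * \1_E x)%:E)))%E.
  apply: ge0_le_integral => //.
  - apply/measurable_EFinP.
    rewrite (_ : (fun x => _) = (@powR R ^~ q) \o
      (fun x => `|invmx (gram (B n) x) i j - invmx S i j|))//.
    apply: measurableT_comp; first exact: measurable_powR.
    by apply: measurableT_comp => //; apply: measurable_funB => //; exact: measurable_gram_inv.
  - by apply: emeasurable_funD => //; apply: measurable_funeM; exact: emeasurable_funD.
  - by move=> x _; exact: dom.
rewrite ge0_integralD//; last 3 first.
- by move=> x _; apply: mule_ge0 => //; rewrite lee_fin.
- by apply: measurable_funeM; exact: emeasurable_funD.
- by move=> x _; rewrite lee_fin mulr_ge0.
rewrite ge0_integralZl//; last exact: emeasurable_funD.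
rewrite ge0_integralD//; last first.
  by move=> x _; exact: det_inv_pow_ge0.
have Eind : Exle (fun x => e^-1 * \1_E x) (del / 2).
  have -> : del / 2 = e^-1 * (e * (del / 2)) by rewrite mulrA mulVf ?mul1r// gt_eqF.
  apply: (Ex_le_scale (g := \1_E)) => //.
  - by apply: measurable_funM => //; exact: measurable_indic.
  - by move=> x; rewrite mulr_ge0.
  - by rewrite Ex_indic.
apply: (@le_trans _ _ ((2 * e * K)%:E * (2%:E + C%:E) + (del / 2)%:E)%E).
  apply: leeD => //; apply: lee_wpmul2l; first by rewrite lee_fin.
  exact: leeD.
change ((2 * e * K * (2 + C) + del / 2)%:E <= del%:E)%E; rewrite lee_fin.
move: eL; rewrite /L; have -> : 2 * e * K * (2 + C) = e * (2 * K * (2 + C)) by ring.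
by rewrite mulrDr mulr1; lra.
Unshelve. all: by end_near. Qed.

End InverseConvergence.

Theorem theorem2p6 (d : measure_display) (T : measurableType d) (R : realType)
  (P : probability T R) (N : nat -> {RV P >-> R})
  (p : nat) (B : forall n : nat, 'I_n -> 'I_p -> T -> R) (Sigma : 'M[R]_p) :
  (0 < p)%N ->
  iid_standard_gaussian N ->
  (forall n (i : 'I_n) (j : 'I_p), in_first_chaos N (B n i j)) ->
  Sigma \in unitmx ->
  (* A_n converges in probability to Sigma (entrywise) *)
  (forall (i j : 'I_p) (eps : R), 0 < eps ->
     P [set x | eps <= `|gram (B n) x i j - Sigma i j|] @[n --> \oo] --> 0%E) ->
  (forall q : R, 1 <= q ->
     exists (N0 : nat) (C : R), 0 < C /\
       forall n, (N0 <= n)%N ->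
         (\int[P]_x det_inv_pow q (gram (B n) x) <= C%:E)%E)
  /\
  (forall q : R, 1 <= q -> forall i j : 'I_p,
     (\int[P]_x ((`|invmx (gram (B n) x) i j - invmx Sigma i j|) `^ q)%:E)%E
       @[n --> \oo] --> 0%E).
Proof.
move=> _ NG BN Su BS; split => [q q1|q q1 i j].
  exact: (gram_det_moment NG BN Su BS q1).
exact: (gram_inv_cvg NG BN Su BS).
Qed.
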